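(* Let $\mathbf{k}$ be a field of characteristic $0$, let $I\subseteq\mathbf{k}[t_1,\dots,t_n]$ be an ideal, and set $R=\mathbf{k}[t_1,\dots,t_n]/I$. Let $\{c_1,\dots,c_r\}\subseteq I$ be a minimal set of generators of $I$ consisting of homogeneous elements of degree at least $3$. Consider the $R$-module $\mathbf{k}=R/\langle\bar t_1,\dots,\bar t_n\rangle$. Then $\mathrm{Spec}(\mathrm{Ext}^*_R(\mathbf{k},\mathbf{k})^{ab})$ contains a closed subscheme isomorphic to the affine space $\mathbb{A}^r$ over $\mathbf{k}$.
   Context: The polynomial ring has its standard grading ($\deg t_i=1$). ''Minimal'' means $c_i\notin\sum_{j\neq i}\mathbf{k}[t_1,\dots,t_n]c_j$ for every $i$. $\mathrm{Ext}^*_R(\mathbf{k},\mathbf{k})$ is a graded associative algebra under the Yoneda product. For an associative algebra $U$, $U^{ab}=U/\langle[U,U]\rangle$ is its universal commutative quotient, i.e. the quotient by the two-sided ideal generated by all commutators. *)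

(* Defs.v *)
From HB Require Import structures.
From mathcomp Require Import all_boot all_order all_algebra.
From mathcomp Require Import mpoly.
From mathcomp Require Import boolp classical_sets functions topology.
From mathcomp Require Import ring.

Set Implicit Arguments.
Unset Strict Implicit.
Unset Printing Implicit Defensive.

Import GRing.Theory.
Local Open Scope classical_set_scope.
Local Open Scope quotient_scope.
Local Open Scope ring_scope.

(* Rings below may be zero (pzRingType), since a universal commutative       *)
(* quotient can be the zero ring; k-algebras are therefore given by their    *)
(* structure morphism from k, as algType requires 1 != 0.                    *)

Section Ideals.
Variable A : pzRingType.
Implicit Types (S J : set A).

Definition two_sided_ideal J : Prop :=
  [/\ J 0, forall x y, J x -> J y -> J (x + y)
    & forall a x, J x -> J (a * x) /\ J (x * a)].

Definition ideal_gen S : set A :=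
  [set x | forall J, two_sided_ideal J -> S `<=` J -> J x].

Lemma ideal_gen_ideal S : two_sided_ideal (ideal_gen S).
Proof.
split.
- by move=> J [].
- by move=> x y Sx Sy J iJ SJ; case: (iJ) => _ + _; apply; [exact: Sx|exact: Sy].
- by move=> a x Sx; split=> J iJ SJ; case: (iJ) => _ _ /(_ a x (Sx J iJ SJ)) [].
Qed.

Definition in_ideal S : {pred A} := fun x => `[< ideal_gen S x >].

Lemma in_ideal_zmod S : zmod_closed (in_ideal S).
Proof.
have [J0 JD JM] := ideal_gen_ideal S.
split=> [|x y /asboolP Jx /asboolP Jy]; first exact/asboolP.
by apply/asboolP; apply: (JD x (- y)) => //; rewrite -mulN1r; case: (JM (-1) y Jy).
Qed.

HB.instance Definition _ S :=
  GRing.isZmodClosed.Build A (in_ideal S) (in_ideal_zmod S).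

End Ideals.

Section QuotientRing.
Variables (A : pzRingType) (S : set A).

Definition quotient_ring : Type := Quotient.quot (in_ideal S).

HB.instance Definition _ := GRing.Zmodule.on quotient_ring.

Definition qproj (x : A) : quotient_ring := \pi_(Quotient.quot (in_ideal S)) x.

Lemma qprojP x y : qproj x = qproj y <-> ideal_gen S (x - y).
Proof.
rewrite /qproj; split=> [/eqP|xy].
  by rewrite -Quotient.idealrBE => /asboolP.
by apply/eqP; rewrite -Quotient.idealrBE; apply/asboolP.
Qed.

Lemma qprojD : {morph qproj : x y / x + y}.
Proof. by move=> x y; rewrite /qproj !piE. Qed.

Lemma qprojB : zmod_morphism qproj.
Proof. by move=> x y; rewrite /qproj !piE. Qed.

Lemma qproj_surj (u : quotient_ring) : exists x, qproj x = u.
Proof. by exists (repr u); rewrite /qproj reprK. Qed.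

Definition qmul (u v : quotient_ring) : quotient_ring :=
  qproj (repr u * repr v).

Lemma qprojM_subproof x y : qproj (x * y) = qmul (qproj x) (qproj y).
Proof.
have [J0 JD JM] := ideal_gen_ideal S.
apply/qprojP; set x' := repr _; set y' := repr _.
have Jx : ideal_gen S (x - x') by apply/qprojP; rewrite /qproj reprK.
have Jy : ideal_gen S (y - y') by apply/qprojP; rewrite /qproj reprK.
have -> : x * y - x' * y' = (x - x') * y + x' * (y - y').
  by rewrite mulrBl mulrBr addrA subrK.
by apply: JD; [case: (JM y _ Jx)|case: (JM x' _ Jy)].
Qed.

Let qmulA : associative qmul.
Proof.
move=> u v w; have [x <-] := qproj_surj u; have [y <-] := qproj_surj v.
by have [z <-] := qproj_surj w; rewrite -!qprojM_subproof mulrA.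
Qed.

Let qmul1r : left_id (qproj 1) qmul.
Proof. by move=> u; have [x <-] := qproj_surj u; rewrite -qprojM_subproof mul1r. Qed.

Let qmulr1 : right_id (qproj 1) qmul.
Proof. by move=> u; have [x <-] := qproj_surj u; rewrite -qprojM_subproof mulr1. Qed.

Let qmulDl : left_distributive qmul +%R.
Proof.
move=> u v w; have [x <-] := qproj_surj u; have [y <-] := qproj_surj v.
have [z <-] := qproj_surj w.
by rewrite -qprojD -!qprojM_subproof -qprojD mulrDl.
Qed.

Let qmulDr : right_distributive qmul +%R.
Proof.
move=> u v w; have [x <-] := qproj_surj u; have [y <-] := qproj_surj v.
have [z <-] := qproj_surj w.
by rewrite -qprojD -!qprojM_subproof -qprojD mulrDr.
Qed.

HB.instance Definition _ := GRing.Zmodule_isPzRing.Build quotient_ring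
  qmulA qmul1r qmulr1 qmulDl qmulDr.

Lemma qproj_monoid : monoid_morphism qproj.
Proof. by split=> // x y; rewrite qprojM_subproof. Qed.

HB.instance Definition _ :=
  GRing.isZmodMorphism.Build A quotient_ring qproj qprojB.
HB.instance Definition _ :=
  GRing.isMonoidMorphism.Build A quotient_ring qproj qproj_monoid.

Definition qscale (a : A) (u : quotient_ring) : quotient_ring := qproj a * u.

Let qscaleA a b u : qscale a (qscale b u) = qscale (a * b) u.
Proof. by rewrite /qscale rmorphM mulrA. Qed.

Let qscale1 : left_id 1 qscale.
Proof. by move=> u; rewrite /qscale rmorph1 mul1r. Qed.

Let qscaleDr : right_distributive qscale +%R.
Proof. by move=> a u v; rewrite /qscale mulrDr. Qed.

Let qscaleDl u : {morph qscale^~ u : a b / a + b}.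
Proof. by move=> a b; rewrite /qscale rmorphD mulrDl. Qed.

(* A / <S> as a left A-module *)
HB.instance Definition _ := GRing.Zmodule_isLmodule.Build A quotient_ring
  qscaleA qscale1 qscaleDr qscaleDl.

End QuotientRing.

Section ComQuotient.
Variables (A : comPzRingType) (S : set A).

Let qmulC : commutative (@GRing.mul (quotient_ring S)).
Proof.
move=> u v; have [x <-] := qproj_surj u; have [y <-] := qproj_surj v.
by rewrite -!rmorphM mulrC.
Qed.

HB.instance Definition _ :=
  GRing.PzRing_hasCommutativeMul.Build (quotient_ring S) qmulC.

End ComQuotient.

Section Abelianization.
Variable A : pzRingType.

Definition commutators : set A := [set z | exists x y, z = x * y - y * x].

Definition abelianization : Type := quotient_ring commutators.

HB.instance Definition _ := GRing.PzRing.on abelianization.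

Let abC : commutative (@GRing.mul abelianization).
Proof.
move=> u v; have [x <-] := qproj_surj u; have [y <-] := qproj_surj v.
rewrite -!rmorphM; apply/qprojP => J _; apply; by exists x, y.
Qed.

HB.instance Definition _ :=
  GRing.PzRing_hasCommutativeMul.Build abelianization abC.

Definition abproj : A -> abelianization := @qproj A commutators.

HB.instance Definition _ := GRing.RMorphism.on abproj.

End Abelianization.

Definition projective (R : pzRingType) (P : lmodType R) : Prop :=
  forall (M N : lmodType R) (g : {linear M -> N}) (f : {linear P -> N}),
    (forall y, exists x, g x = y) ->
    exists h : {linear P -> M}, forall x, g (h x) = f x.

Record proj_resolution (R : pzRingType) (M : lmodType R) := ProjResolution {
  res_obj :> nat -> lmodType R;
  res_d : forall i, {linear res_obj i.+1 -> res_obj i};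
  res_aug : {linear res_obj 0%N -> M};
  res_projective : forall i, projective (res_obj i);
  res_aug_surj : forall m, exists x, res_aug x = m;
  res_exact0 : forall x, res_aug x = 0 <-> exists y, res_d 0 y = x;
  res_exactS : forall i x, res_d i x = 0 <-> exists y, res_d i.+1 y = x
}.

(* Ext^*_R(M, M) as the cohomology of the differential graded algebra        *)
(* (+)_i Hom^i_R(P, P), Hom^i_R(P, P) = prod_p Hom_R(P_p, P_(p-i)), of a     *)
(* projective resolution P of M; composition of cocycles induces the Yoneda  *)
(* product.  The cohomology vanishes in negative degrees, so only cocycles   *)
(* of degree >= 0 are considered.  A not necessarily homogeneous f is given  *)
(* by its components f p q : P_p -> P_q, of cohomological degree p - q.      *)
(* The coboundaries form an ideal of the ring of cocycles, so the quotient   *)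
(* by the ideal they generate is the cohomology.                             *)

Section ExtAlgebra.
Variables (R : comPzRingType) (M : lmodType R) (P : proj_resolution M).

Definition hom_family : Type := forall p q, P p -> P q.

Definition hom_linear (f : hom_family) : Prop := forall p q, linear (f p q).

Definition is_cocycle (f : hom_family) : Prop :=
  [/\ hom_linear f,
      exists N, forall p q x, ~~ (q <= p <= q + N)%N -> f p q x = 0
    & forall p q x, res_d P q (f p.+1 q.+1 x) =
                    (-1) ^+ (p + q) *: f p q (res_d P p x)].

Record cocycle := Cocycle {
  component :> forall p q, P p -> P q;
  cocycleP : is_cocycle component
}.

Lemma cocycle_ext (f g : cocycle) : (forall p q x, f p q x = g p q x) -> f = g.
Proof.
case: f g => [f fP] [g gP] /= fg.
have fg' : f = g.
  apply: functional_extensionality_dep => p.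
  apply: functional_extensionality_dep => q; exact/funext.
by move: gP; rewrite -fg' => gP; rewrite (Prop_irrelevance fP gP).
Qed.

HB.instance Definition _ := gen_eqMixin cocycle.
HB.instance Definition _ := gen_choiceMixin cocycle.

Section CocycleTheory.
Implicit Types f g h : cocycle.

Lemma cocycle_linear f p q : linear (f p q).
Proof. by case: (cocycleP f). Qed.

Lemma cocycle_gt f p q x : (p < q)%N -> f p q x = 0.
Proof.
by case: (cocycleP f) => _ [N fN] _ pq; apply: fN; rewrite leqNgt pq.
Qed.

Lemma cocycle_d f p q x : res_d P q (f p.+1 q.+1 x) =
  (-1) ^+ (p + q) *: f p q (res_d P p x).
Proof. by case: (cocycleP f). Qed.

Lemma cocycleD f p q : {morph f p q : x y / x + y}.
Proof. by move=> x y; have := @cocycle_linear f p q 1 x y; rewrite !scale1r. Qed.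

Lemma cocycle0 f p q : f p q 0 = 0.
Proof. by apply: (addrI (f p q 0)); rewrite -cocycleD !addr0. Qed.

Lemma cocycleZ f p q a x : f p q (a *: x) = a *: f p q x.
Proof. by have := @cocycle_linear f p q a x 0; rewrite cocycle0 !addr0. Qed.

Lemma cocycle_sum f p q (I : Type) (r : seq I) (F : I -> P p) :
  f p q (\sum_(i <- r) F i) = \sum_(i <- r) f p q (F i).
Proof. exact: (big_morph _ (@cocycleD f p q) (@cocycle0 f p q)). Qed.

End CocycleTheory.

Lemma coc0_subproof : is_cocycle (fun p q x => 0).
Proof.
split=> [p q a x y|| p q x]; last by rewrite linear0 scaler0.
  by rewrite scaler0 addr0.
by exists 0%N.
Qed.
Definition coc0 := Cocycle coc0_subproof.

Lemma coc_opp_subproof (f : cocycle) : is_cocycle (fun p q x => - f p q x).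
Proof.
case: (cocycleP f) => flin [N fN] fd; split=> [p q a x y||p q x].
- by rewrite flin opprD scalerN.
- by exists N => p q x /fN ->; rewrite oppr0.
- by rewrite linearN fd scalerN.
Qed.
Definition coc_opp f := Cocycle (coc_opp_subproof f).

Lemma coc_add_subproof (f g : cocycle) :
  is_cocycle (fun p q x => f p q x + g p q x).
Proof.
case: (cocycleP f) (cocycleP g) => [flin [N fN] fd] [glin [N' gN] gd].
split=> [p q a x y||p q x].
- by rewrite flin glin scalerDr addrACA.
- exists (N + N')%N => p q x pq; rewrite fN ?gN ?addr0 //.
  + apply: contra pq => /andP[-> /leq_trans->] //.
    by rewrite leq_add2l leq_addl.
  + apply: contra pq => /andP[-> /leq_trans->] //.
    by rewrite leq_add2l leq_addr.
- by rewrite linearD fd gd scalerDr.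
Qed.
Definition coc_add f g := Cocycle (coc_add_subproof f g).

Definition id_component p q : P p -> P q :=
  if p =P q is ReflectT pq then fun x => ecast i (P i) pq x else fun=> 0.

Lemma id_componentE p x : @id_component p p x = x.
Proof. by rewrite /id_component; case: eqP => // pp; rewrite eq_axiomK. Qed.

Lemma id_component0 p q x : p != q -> @id_component p q x = 0.
Proof. by rewrite /id_component; case: eqP. Qed.

Lemma coc1_subproof : is_cocycle id_component.
Proof.
split=> [p q a x y||p q x].
- case: (eqVneq p q) => [<-|pq]; first by rewrite !id_componentE.
  by rewrite !id_component0 // scaler0 addr0.
- exists 0%N => p q x; rewrite addn0 -eqn_leq eq_sym; exact: id_component0.
- case: (eqVneq p q) => [<-|pq].
    by rewrite !id_componentE -signr_odd oddD addbb scale1r.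
  by rewrite !id_component0 ?eqSS // linear0 scaler0.
Qed.
Definition coc1 := Cocycle coc1_subproof.

Lemma coc_mul_subproof (f g : cocycle) :
  is_cocycle (fun p q x => \sum_(m < p.+1) f m q (g p m x)).
Proof.
case: (cocycleP f) (cocycleP g) => [flin [N fN] fd] [glin [N' gN] gd].
split=> [p q a x y||p q x].
- rewrite scaler_sumr -big_split /=; apply: eq_bigr => m _.
  by rewrite glin flin.
- exists (N + N')%N => p q x pq; apply: big1 => m _.
  have [mq|/fN->//] := boolP (q <= m <= q + N)%N.
  have [pm|/gN->] := boolP (m <= p <= m + N')%N; last exact: cocycle0.
  case/negP: pq; case/andP: mq => qm mq; case/andP: pm => mp pm.
  rewrite (leq_trans qm mp) /= (leq_trans pm) // addnA leq_add2r //.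
- rewrite big_ord_recl cocycle_gt // add0r linear_sum /= scaler_sumr.
  apply: eq_bigr => m _; rewrite fd gd cocycleZ scalerA; congr (_ *: _).
  by rewrite -exprD -signr_odd -[in RHS]signr_odd !oddD; case: odd; case: odd; case: odd.
Qed.
Definition coc_mul f g := Cocycle (coc_mul_subproof f g).

Let cocA : associative coc_add.
Proof. by move=> f g h; apply: cocycle_ext => p q x /=; rewrite addrA. Qed.

Let cocC : commutative coc_add.
Proof. by move=> f g; apply: cocycle_ext => p q x /=; rewrite addrC. Qed.

Let coc0r : left_id coc0 coc_add.
Proof. by move=> f; apply: cocycle_ext => p q x /=; rewrite add0r. Qed.

Let cocNr : left_inverse coc0 coc_opp coc_add.
Proof. by move=> f; apply: cocycle_ext => p q x /=; rewrite addNr. Qed.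

Let cocmA : associative coc_mul.
Proof.
move=> f g h; apply: cocycle_ext => p q x /=.
transitivity (\sum_(l < p.+1) \sum_(m < p.+1) f m q (g l m (h p l x))).
  by rewrite exchange_big; apply: eq_bigr => m _; rewrite cocycle_sum.
apply: eq_bigr => l _.
rewrite (@big_ord_widen _ _ _ l.+1 p.+1 (fun m => f m q (g l m (h p l x)))) //.
rewrite [RHS]big_mkcond; apply: eq_bigr => m _.
by case: ltnP => // lm; rewrite (cocycle_gt g) ?cocycle0.
Qed.

Let coc1m : left_id coc1 coc_mul.
Proof.
move=> f; apply: cocycle_ext => p q x /=.
case: (leqP q p) => [qp|pq]; last first.
  rewrite cocycle_gt //; apply: big1 => m _; apply: id_component0.
  by rewrite neq_ltn (leq_trans (ltn_ord m)).
rewrite (bigD1 (Ordinal (qp : (q < p.+1)%N))) //= id_componentE big1 ?addr0 //.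
by move=> m mq; apply: id_component0.
Qed.

Let cocm1 : right_id coc1 coc_mul.
Proof.
move=> f; apply: cocycle_ext => p q x /=.
rewrite (bigD1 ord_max) //= id_componentE big1 ?addr0 // => m mp.
by rewrite id_component0 ?cocycle0 // eq_sym.
Qed.

Let cocmDl : left_distributive coc_mul coc_add.
Proof.
by move=> f g h; apply: cocycle_ext => p q x /=; rewrite -big_split.
Qed.

Let cocmDr : right_distributive coc_mul coc_add.
Proof.
move=> f g h; apply: cocycle_ext => p q x /=; rewrite -big_split /=.
by apply: eq_bigr => m _; rewrite cocycleD.
Qed.

HB.instance Definition _ :=
  GRing.isZmodule.Build cocycle cocA cocC coc0r cocNr.
HB.instance Definition _ :=
  GRing.Zmodule_isPzRing.Build cocycle cocmA coc1m cocm1 cocmDl cocmDr.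

Lemma coc_scalar_subproof (a : R) :
  is_cocycle (fun p q x => a *: id_component q x).
Proof.
case: coc1_subproof => lin [N idN] idd; split=> [p q b x y||p q x].
- by rewrite lin scalerDr !scalerA mulrC.
- by exists N => p q x /idN ->; rewrite scaler0.
- by rewrite linearZ /= idd !scalerA mulrC.
Qed.

Definition coc_scalar (a : R) : cocycle := Cocycle (coc_scalar_subproof a).

Let coc_scalarB : zmod_morphism coc_scalar.
Proof. by move=> a b; apply: cocycle_ext => p q x /=; rewrite scalerBl. Qed.

Let coc_scalarM : monoid_morphism coc_scalar.
Proof.
split=> [|a b]; first by apply: cocycle_ext => p q x /=; rewrite scale1r.
apply: cocycle_ext => p q x.
have /(congr1 (fun f : cocycle => f p q x)) /= := cocm1 coc1 => <-.
rewrite scaler_sumr; apply: eq_bigr => m _ /=.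
by have := @cocycleZ coc1 m q b; rewrite /= => ->; rewrite scalerA.
Qed.

HB.instance Definition _ :=
  GRing.isZmodMorphism.Build R cocycle coc_scalar coc_scalarB.
HB.instance Definition _ :=
  GRing.isMonoidMorphism.Build R cocycle coc_scalar coc_scalarM.

(* D h = d h - (-1)^|h| h d; the component of D h from P_p to P_q involves   *)
(* components of h of degree p - q - 1.                                      *)
Definition hom_differential (h : hom_family) : hom_family := fun p q x =>
  res_d P q (h p q.+1 x) +
  match p return P p -> P q with
  | 0%N => fun=> 0
  | p'.+1 => fun x => (-1) ^+ (p'.+1 + q) *: h p' q (res_d P p' x)
  end x.

Definition coboundaries : set cocycle :=
  [set f : cocycle | exists h : hom_family,
     [/\ hom_linear h,
         exists N, forall p q x, ~~ (q <= p.+1 <= q + N)%N -> h p q x = 0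
       & forall p q x, f p q x = @hom_differential h p q x]].

Definition Ext : Type := quotient_ring coboundaries.

HB.instance Definition _ := GRing.PzRing.on Ext.

Definition Ext_scalar (a : R) : Ext := @qproj cocycle coboundaries (coc_scalar a).

HB.instance Definition _ :=
  GRing.RMorphism.copy Ext_scalar (@qproj cocycle coboundaries \o coc_scalar).

End ExtAlgebra.

Definition prime_ideal (A : comPzRingType) (J : set A) : Prop :=
  [/\ two_sided_ideal J, ~ J 1 & forall a b, J (a * b) -> J a \/ J b].

Record Spec (A : comPzRingType) :=
  MkSpec { Spec_ideal :> A -> Prop; Spec_prime : prime_ideal Spec_ideal }.

Section Zariski.
Variable A : comPzRingType.

HB.instance Definition _ := gen_eqMixin (Spec A).
HB.instance Definition _ := gen_choiceMixin (Spec A).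

Definition zariski_open (U : set (Spec A)) : Prop :=
  exists S : set A, U = [set p : Spec A | ~ (S `<=` p)].

Let zariski_openT : zariski_open setT.
Proof.
exists setT; apply/esym; rewrite -subTset => p _ /= Tp.
by case: (Spec_prime p) => _ + _; apply; exact: Tp.
Qed.

Let zariski_openI : setI_closed zariski_open.
Proof.
move=> _ _ [S ->] [T ->].
exists [set z | exists x y, [/\ S x, T y & z = x * y]].
apply/seteqP; split=> p /=; case: (Spec_prime p) => [[p0 pD pM] p1 pP].
  case=> [/existsNP[x /not_implyP[Sx px]] /existsNP[y /not_implyP[Ty py]]].
  move=> /(_ (x * y)) /= STp; have /pP[//|//] : p (x * y).
  by apply: STp; exists x, y.
move=> STp; split=> Sp; apply: STp => _ [x [y [Sx Ty ->]]].
  by case: (pM y x (Sp _ Sx)).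
by case: (pM x y (Sp _ Ty)).
Qed.

Let zariski_openU (I : Type) (f : I -> set (Spec A)) :
  (forall i, zariski_open (f i)) -> zariski_open (\bigcup_i f i).
Proof.
move=> /choice[S fS]; exists (\bigcup_i S i).
apply/seteqP; split=> p /=.
  case=> i _; rewrite fS /= => Sp SUp; apply: Sp => x Sx.
  by apply: SUp; exists i.
move=> /existsNP[x /not_implyP[[i _ Six] px]]; exists i => //.
by rewrite fS /= => /(_ x Six).
Qed.

HB.instance Definition _ := isOpenTopological.Build (Spec A)
  zariski_openT zariski_openI zariski_openU.

End Zariski.

Section Localization.
Variables (A : comPzRingType) (p : Spec A).

Record fraction :=
  Fraction { numer : A; denom : A; denomP : ~ Spec_ideal p denom }.

HB.instance Definition _ := gen_eqMixin fraction.
HB.instance Definition _ := gen_choiceMixin fraction.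

Definition frac_equiv (x y : fraction) : bool :=
  `[< exists u, ~ p u /\ u * (numer x * denom y) = u * (numer y * denom x) >].

Let prime1 : ~ p 1.
Proof. by case: (Spec_prime p). Qed.

Let primeM a b : ~ p a -> ~ p b -> ~ p (a * b).
Proof. by case: (Spec_prime p) => _ _ pP pa pb /pP[]. Qed.

Lemma frac_equiv_is_equiv : equiv_class_of frac_equiv.
Proof.
split=> [x|x y|y x z].
- by apply/asboolP; exists 1.
- by apply/asboolP/asboolP=> -[u [pu e]]; exists u.
- move=> /asboolP[u [pu e]] /asboolP[v [pv e']]; apply/asboolP.
  exists (u * v * denom y); split.
    by apply: primeM; [exact: primeM|exact: denomP].
  transitivity (v * denom z * (u * (numer x * denom y))); first by ring.
  rewrite e; transitivity (u * denom x * (v * (numer y * denom z))); first by ring.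
  by rewrite e'; ring.
Qed.

Canonical frac_equiv_rel := EquivRelPack frac_equiv_is_equiv.
Canonical frac_enc := defaultEncModRel frac_equiv.

(* The stalk A_p of the structure sheaf at p. *)
Definition localization : Type := {eq_quot frac_equiv}.

HB.instance Definition _ := Choice.on localization.

Definition toloc (x : fraction) : localization := \pi_{eq_quot frac_equiv} x.

Lemma tolocP x y : toloc x = toloc y <->
  exists u, ~ p u /\ u * (numer x * denom y) = u * (numer y * denom x).
Proof.
rewrite /toloc; split=> [/eqP|e].
  by rewrite eqmodE => /asboolP.
by apply/eqP; rewrite eqmodE; apply/asboolP.
Qed.

Lemma toloc_surj (u : localization) : exists x, toloc x = u.
Proof. by exists (repr u); rewrite /toloc reprK. Qed.

Definition frac_of (a : A) : fraction := @Fraction a 1 prime1.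
Definition frac_opp (x : fraction) := @Fraction (- numer x) _ (@denomP x).
Definition frac_add (x y : fraction) :=
  @Fraction (numer x * denom y + numer y * denom x) (denom x * denom y)
            (primeM (@denomP x) (@denomP y)).
Definition frac_mul (x y : fraction) :=
  @Fraction (numer x * numer y) (denom x * denom y)
            (primeM (@denomP x) (@denomP y)).

Definition loc_opp (u : localization) := toloc (frac_opp (repr u)).
Definition loc_add (u v : localization) := toloc (frac_add (repr u) (repr v)).
Definition loc_mul (u v : localization) := toloc (frac_mul (repr u) (repr v)).

Lemma toloc_opp x : toloc (frac_opp x) = loc_opp (toloc x).
Proof.
have /tolocP[u [pu e]] : toloc x = toloc (repr (toloc x)) by rewrite /toloc reprK.
by apply/tolocP; exists u; split=> //=; rewrite !mulNr !mulrN e.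
Qed.

Lemma toloc_add x y : toloc (frac_add x y) = loc_add (toloc x) (toloc y).
Proof.
have /tolocP[u [pu e]] : toloc x = toloc (repr (toloc x)) by rewrite /toloc reprK.
have /tolocP[v [pv e']] : toloc y = toloc (repr (toloc y)) by rewrite /toloc reprK.
apply/tolocP; exists (u * v); split=> /=; first exact: primeM.
set x' := repr _ in e *; set y' := repr _ in e' *.
transitivity (v * denom y * denom y' * (u * (numer x * denom x')) +
              u * denom x * denom x' * (v * (numer y * denom y'))); first by ring.
by rewrite e e'; ring.
Qed.

Lemma toloc_mul x y : toloc (frac_mul x y) = loc_mul (toloc x) (toloc y).
Proof.
have /tolocP[u [pu e]] : toloc x = toloc (repr (toloc x)) by rewrite /toloc reprK.
have /tolocP[v [pv e']] : toloc y = toloc (repr (toloc y)) by rewrite /toloc reprK.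
apply/tolocP; exists (u * v); split=> /=; first exact: primeM.
set x' := repr _ in e *; set y' := repr _ in e' *.
transitivity ((u * (numer x * denom x')) * (v * (numer y * denom y'))); first by ring.
by rewrite e e'; ring.
Qed.

Let toloc_eq x y : numer x * denom y = numer y * denom x -> toloc x = toloc y.
Proof. by move=> e; apply/tolocP; exists 1; rewrite e. Qed.

Let loc_addA : associative loc_add.
Proof.
move=> u v w; have [x <-] := toloc_surj u; have [y <-] := toloc_surj v.
have [z <-] := toloc_surj w; rewrite -!toloc_add; apply: toloc_eq => /=; ring.
Qed.

Let loc_addC : commutative loc_add.
Proof.
move=> u v; have [x <-] := toloc_surj u; have [y <-] := toloc_surj v.
rewrite -!toloc_add; apply: toloc_eq => /=; ring.
Qed.

Let loc_add0 : left_id (toloc (frac_of 0)) loc_add.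
Proof.
move=> u; have [x <-] := toloc_surj u.
rewrite -!toloc_add; apply: toloc_eq => /=; ring.
Qed.

Let loc_addN : left_inverse (toloc (frac_of 0)) loc_opp loc_add.
Proof.
move=> u; have [x <-] := toloc_surj u.
rewrite -toloc_opp -!toloc_add; apply: toloc_eq => /=; ring.
Qed.

Let loc_mulA : associative loc_mul.
Proof.
move=> u v w; have [x <-] := toloc_surj u; have [y <-] := toloc_surj v.
have [z <-] := toloc_surj w; rewrite -!toloc_mul; apply: toloc_eq => /=; ring.
Qed.

Let loc_mulC : commutative loc_mul.
Proof.
move=> u v; have [x <-] := toloc_surj u; have [y <-] := toloc_surj v.
rewrite -!toloc_mul; apply: toloc_eq => /=; ring.
Qed.

Let loc_mul1 : left_id (toloc (frac_of 1)) loc_mul.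
Proof.
move=> u; have [x <-] := toloc_surj u.
rewrite -!toloc_mul; apply: toloc_eq => /=; ring.
Qed.

Let loc_mulD : left_distributive loc_mul loc_add.
Proof.
move=> u v w; have [x <-] := toloc_surj u; have [y <-] := toloc_surj v.
have [z <-] := toloc_surj w; rewrite -!(toloc_mul, toloc_add).
apply: toloc_eq => /=; ring.
Qed.

Let loc_mulr1 : right_id (toloc (frac_of 1)) loc_mul.
Proof. by move=> u; rewrite loc_mulC loc_mul1. Qed.

Let loc_mulDr : right_distributive loc_mul loc_add.
Proof. by move=> u v w; rewrite loc_mulC loc_mulD !(loc_mulC u). Qed.

HB.instance Definition _ :=
  GRing.isZmodule.Build localization loc_addA loc_addC loc_add0 loc_addN.
HB.instance Definition _ := GRing.Zmodule_isPzRing.Build localization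
  loc_mulA loc_mul1 loc_mulr1 loc_mulD loc_mulDr.
HB.instance Definition _ :=
  GRing.PzRing_hasCommutativeMul.Build localization loc_mulC.

Definition loc_in (a : A) : localization := toloc (frac_of a).

Let loc_inB : zmod_morphism loc_in.
Proof.
move=> a b; rewrite /loc_in.
rewrite -[RHS]/(loc_add (toloc _) (loc_opp (toloc _))) -toloc_opp -toloc_add.
apply: toloc_eq => /=; ring.
Qed.

Let loc_inM : monoid_morphism loc_in.
Proof.
split=> // a b; rewrite /loc_in.
rewrite -[RHS]/(loc_mul (toloc _) (toloc _)) -toloc_mul; apply: toloc_eq => /=; ring.
Qed.

HB.instance Definition _ := GRing.isZmodMorphism.Build A localization loc_in loc_inB.
HB.instance Definition _ := GRing.isMonoidMorphism.Build A localization loc_in loc_inM.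

End Localization.

(* s restricts to a section over U of the structure sheaf of Spec A: near    *)
(* each point of U it is given by one fraction a / b.  Values outside U are  *)
(* irrelevant.                                                               *)
Definition is_section (A : comPzRingType) (U : set (Spec A))
    (s : forall p : Spec A, localization p) : Prop :=
  forall p, U p -> exists a b, \forall q \near p,
    exists bq : ~ Spec_ideal q b, s q = toloc (@Fraction A q a b bq).

Definition invertible (A : pzRingType) (x : A) : Prop :=
  exists y, x * y = 1 /\ y * x = 1.

(* Morphisms Spec B -> Spec A of locally ringed spaces.  As the structure    *)
(* sheaves are sheaves of functions with values in their stalks, a morphism  *)
(* of sheaves O_(Spec A) -> base_* O_(Spec B) is the same as a family of     *)
(* homomorphisms between stalks that takes sections to sections.             *)
Record Spec_morphism (B A : comPzRingType) := SpecMorphism {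
  base :> Spec B -> Spec A;
  stalk_map : forall p : Spec B, {rmorphism localization (base p) -> localization p};
  base_continuous : continuous base;
  stalk_map_section : forall (U : set (Spec A)) s, open U -> is_section U s ->
    is_section (base @^-1` U) (fun p => stalk_map p (s (base p)));
  stalk_map_local : forall p x, invertible (stalk_map p x) -> invertible x
}.

(* Homeomorphism onto a closed subset, and surjective on structure sheaves;  *)
(* the latter is tested on stalks.                                           *)
Definition closed_immersion (B A : comPzRingType) (f : Spec_morphism B A) : Prop :=
  [/\ injective f, forall C, closed C -> closed (f @` C)
    & forall p (y : localization p), exists x, stalk_map f p x = y].

(* Compatibility of f with the structure morphisms to Spec k that are given  *)
(* by the ring homomorphisms iA and iB.                                      *)
Definition morphism_over (k B A : comPzRingType) (iB : {rmorphism k -> B})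
    (iA : {rmorphism k -> A}) (f : Spec_morphism B A) : Prop :=
  forall p c, stalk_map f p (loc_in (f p) (iA c)) = loc_in p (iB c).

(* Spec A, for the k-algebra iA : k -> A, contains a closed subscheme        *)
(* isomorphic over k to A^r = Spec k[x_1, ..., x_r]; a closed subscheme is   *)
(* an isomorphism class of closed immersions.                                *)
Definition has_closed_affine_space (k : fieldType) (A : comPzRingType)
    (iA : {rmorphism k -> A}) (r : nat) : Prop :=
  exists f : Spec_morphism {mpoly k[r]} A,
    closed_immersion f /\ morphism_over (@mpolyC r k) iA f.

Section Presentation.
Variables (k : fieldType) (n : nat) (I : set {mpoly k[n]}).

Definition coord_ring : Type := quotient_ring I.

HB.instance Definition _ := GRing.ComPzRing.on coord_ring.

Definition coord_proj : {mpoly k[n]} -> coord_ring := @qproj _ I.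

HB.instance Definition _ := GRing.RMorphism.on coord_proj.

Definition residue_module : lmodType coord_ring :=
  quotient_ring (range (fun i : 'I_n => coord_proj 'X_i)).

Definition Ext_ab_scalar (P : proj_resolution residue_module) :
    k -> abelianization (Ext P) :=
  @abproj _ \o @Ext_scalar _ _ P \o coord_proj \o @mpolyC n k.

HB.instance Definition _ P := GRing.RMorphism.on (@Ext_ab_scalar P).

End Presentation.

(* Main.v *)
Require Import Defs.
From HB Require Import structures.
From mathcomp Require Import all_boot all_order all_algebra.
From mathcomp Require Import mpoly.
From mathcomp Require Import boolp classical_sets functions topology.
From mathcomp Require Import ring.
Set Implicit Arguments.
Unset Strict Implicit.
Unset Printing Implicit Defensive.
Import GRing.Theory.
Local Open Scope ring_scope.

(** It is enough to produce a surjective homomorphism of k-algebras from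
    Ext_R(k, k) onto the polynomial ring k[x_1, ..., x_r]: the target being
    commutative, it factors through the universal commutative quotient, and
    a surjection of rings is a closed immersion of spectra.

    Such a homomorphism comes from a module on which Ext acts.  As every c_j
    vanishes to order at least 3, one can write c_j = sum_i t_i c_ji and
    c_ji = sum_m c_jim t_m with all c_jim in the maximal ideal.  The Koszul
    matrix factorization of W = sum_j x_j c_j is the exterior algebra on
    e_1, ..., e_n over k[t][x], with the operator
      d_K = sum_i t_i (contraction by e_i) + sum_(i, j) x_j c_ji (e_i wedge _),
    whose square is W.  Over R the potential W vanishes, so d_K is a
    differential there, and for a projective resolution P of k the product
    total complex of P (x) K has homology k (x) K = Lambda[[x]], since d_K is
    zero modulo the maximal ideal (total_d_lift).  Cocycles of Hom_R(P, P)
    act on this homology, linearly in x (total_d_act).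

    The operators (contraction by e_i) - sum_(j, m) c_jim x_j (e_m wedge _)
    anticommute with d_K (contraction_koszul) and reduce to the contractions
    modulo the maximal ideal; this is where degree at least 3 is used.  So if
    z is a cycle representing 1, the class of f z is killed by all
    contractions, that is, it is a series in x without exterior part
    (aug_act_support).  Taking f to the series symbol f with
    f z = (symbol f) z in homology is therefore multiplicative (symbolM), and
    it kills coboundaries.  Homogeneity of z (weight_at) together with the
    boundedness of f makes the series a polynomial.

    For surjectivity, lift the start of P to R^n -> R and send y in P_2 with
    d y in the second syzygies to the class of sum_i t_i (d y)_i in I / m I.
    By minimality and homogeneity the c_j form a basis of I / m I
    (minimal_relation_const), and on the component of z at x_l this map takes
    the value - c_l (degree_two_functional).  Coordinates of I / m I hence
    extend to cocycles of degree 2 whose symbols are the variables x_j. *)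

(** * Exterior algebra operators on power series *)
Section Clifford.
Variables (R : comPzRingType) (n r : nat).

(** The coefficient at a set S and a monomial a is that of the wedge of the
    e_i, i in S, times x^a: these are the elements of V (x) Lambda[[x]].
    Using series avoids any finiteness condition on the coefficients. *)
Definition ext_series (V : lmodType R) : Type := {set 'I_n} -> 'X_{1..r} -> V.

HB.instance Definition _ V := GRing.Lmodule.on (ext_series V).

Definition toggle (i : 'I_n) (S : {set 'I_n}) : {set 'I_n} :=
  [set j | (j \in S) (+) (j == i)].

(** The sign of e_i wedge (wedge of S) is (-1) to this number. *)
Definition inversions (i : 'I_n) (S : {set 'I_n}) : nat :=
  \sum_(j < n) ((j \in S) && (j < i)%N).

Lemma in_toggle i j S : (i \in toggle j S) = (i \in S) (+) (i == j).
Proof. by rewrite inE. Qed.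

Lemma toggleC i j S : toggle i (toggle j S) = toggle j (toggle i S).
Proof. by apply/setP => l; rewrite !in_toggle addbAC. Qed.

Lemma toggleK i S : toggle i (toggle i S) = S.
Proof. by apply/setP => l; rewrite !in_toggle -addbA addbb addbF. Qed.

Lemma odd_inversions_toggle i j S :
  odd (inversions i (toggle j S)) = (j < i)%N (+) odd (inversions i S).
Proof.
rewrite /inversions (bigD1 j) //= [in RHS](bigD1 j) //= !oddD !in_toggle eqxx.
rewrite (eq_bigr (fun l : 'I_n => ((l \in S) && (l < i)%N : nat))); last first.
  by move=> l lj; rewrite in_toggle (negPf lj) addbF.
by case: (odd (\sum_(_ < n | _) _)); case: (j \in S); case: (j < i)%N.
Qed.

(** Exterior multiplication by e_i if b is true, contraction by e_i if b is
    false.  Both act by toggling i, which lets one computation prove all the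
    anticommutation relations. *)
Definition clifford (b : bool) (V : lmodType R) (i : 'I_n) (u : ext_series V) :
    ext_series V :=
  fun S a => if (i \in S) == b then (-1) ^+ inversions i S *: u (toggle i S) a
             else 0.

(** Multiplication by the monomial x^b. *)
Definition shift (V : lmodType R) (b : 'X_{1..r}) (u : ext_series V) :
    ext_series V :=
  fun S a => if (b <= a)%MM then u S (a - b)%MM else 0.

Lemma clifford_linear b V i : linear (@clifford b V i).
Proof.
move=> c u v; apply/funext => S; apply/funext => a; rewrite /clifford /=.
rewrite !fctE; case: ifP => _; last by rewrite scaler0 addr0.
by rewrite scalerDr !scalerA mulrC.
Qed.
HB.instance Definition _ b V i :=
  GRing.isLinear.Build R (ext_series V) (ext_series V) _ _ (@clifford_linear b V i).

Lemma shift_linear V b : linear (@shift V b).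
Proof.
move=> c u v; apply/funext => S; apply/funext => a; rewrite /shift /= !fctE.
by case: ifP => _ //; rewrite scaler0 addr0.
Qed.
HB.instance Definition _ V b :=
  GRing.isLinear.Build R (ext_series V) (ext_series V) _ _ (@shift_linear V b).

(** For i different from j the two orders of toggling differ by exactly one
    sign, because exactly one of i < j and j < i holds. *)
Lemma cliffordC b b' V i j (u : ext_series V) :
  clifford b i (clifford b' j u) + clifford b' j (clifford b i u) =
  if (i == j) && (b != b') then u else 0.
Proof.
apply/funext => S; apply/funext => a; rewrite fctE /clifford !in_toggle.
have [<-|ij] /= := eqVneq i j.
  have sq : (-1) ^+ inversions i S * (-1) ^+ inversions i (toggle i S) = 1 :> R.
    rewrite -exprD -signr_odd oddD odd_inversions_toggle ltnn.
    by rewrite addbb.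
  case: (i \in S); case: b; case: b' => /=;
  by rewrite ?scaler0 ?addr0 ?add0r ?toggleK ?scalerA ?sq ?scale1r.
rewrite fctE !addbF (toggleC j i).
case: ifP => _; case: ifP => _; rewrite ?scaler0 ?addr0 //.
rewrite !scalerA -!exprD -signr_odd -[in X in _ + X]signr_odd.
rewrite !oddD !odd_inversions_toggle -scalerDl.
rewrite (_ : (i < j)%N = ~~ (j < i)%N); last first.
  by rewrite -leqNgt [RHS]leq_eqVlt val_eqE (negPf ij).
set x := odd _; set y := odd _; case: (j < i)%N; case: x; case: y => /=.
all: by rewrite ?addNr ?subrr ?scale0r.
Qed.

Lemma shift_clifford b V i e (u : ext_series V) :
  shift e (clifford b i u) = clifford b i (shift e u).
Proof.
apply/funext => S; apply/funext => a; rewrite /shift /clifford.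
by do 2!case: ifP => // _; rewrite scaler0.
Qed.

Lemma shiftC V e e' (u : ext_series V) : shift e (shift e' u) = shift e' (shift e u).
Proof.
apply/funext => S; apply/funext => a; rewrite /shift.
have le_sub (x y : 'X_{1..r}) : (x <= a)%MM ->
    (y <= a - x)%MM = (x + y <= a)%MM.
  move=> /mnm_lepP xa; apply/mnm_lepP/mnm_lepP => h i; move: (h i) (xa i);
  by rewrite mnmBE mnmDE => + ?; rewrite leq_subRL.
have lel (x y : 'X_{1..r}) : (x + y <= a)%MM -> (x <= a)%MM.
  by move=> /mnm_lepP h; apply/mnm_lepP => i; apply: leq_trans (h i); rewrite mnmDE leq_addr.
have [ea|ea] := boolP (e <= a)%MM; have [e'a|e'a] := boolP (e' <= a)%MM.
- rewrite !le_sub // addmC; case: ifP => // _; congr (u S _).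
  by apply/mnmP => i; rewrite !mnmBE subnAC.
- rewrite le_sub //; case: ifP => // /[dup]; rewrite addmC => /lel.
  by rewrite (negPf e'a).
- by rewrite le_sub //; case: ifP => // /[dup]; rewrite addmC => /lel; rewrite (negPf ea).
- by [].
Qed.

Definition map_coef (V W : lmodType R) (h : V -> W) (u : ext_series V) : ext_series W :=
  fun S a => h (u S a).

Lemma map_coef_linear (V W : lmodType R) (h : {linear V -> W}) : linear (map_coef h).
Proof.
by move=> c u v; apply/funext => S; apply/funext => a; rewrite /map_coef !fctE linearP.
Qed.
HB.instance Definition _ (V W : lmodType R) (h : {linear V -> W}) :=
  GRing.isLinear.Build R (ext_series V) (ext_series W) _ (map_coef h) (map_coef_linear h).

Lemma map_coef_clifford b (V W : lmodType R) (h : {linear V -> W}) i u :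
  map_coef h (clifford b i u) = clifford b i (map_coef h u).
Proof.
apply/funext => S; apply/funext => a; rewrite /clifford /map_coef.
by case: ifP => _; rewrite ?linear0 ?linearZ.
Qed.

Lemma map_coef_shift (V W : lmodType R) (h : {linear V -> W}) e u :
  map_coef h (shift e u) = shift e (map_coef h u).
Proof.
apply/funext => S; apply/funext => a; rewrite /shift /map_coef.
by case: ifP; rewrite ?linear0.
Qed.

End Clifford.

(** * The Koszul matrix factorization *)
Lemma sum_alternating (V : nmodType) n (G : 'I_n -> 'I_n -> V) :
  (forall i, G i i = 0) -> (forall i j, G i j + G j i = 0) ->
  \sum_i \sum_j G i j = 0.
Proof.
elim: n G => [|n IH] G G0 GA; first by rewrite big_ord0.
have row i : \sum_j G i j = G i ord0 + \sum_j G i (lift ord0 j).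
  exact: big_ord_recl.
rewrite big_ord_recl row G0 add0r.
rewrite [X in _ + X](eq_bigr (fun i => G (lift ord0 i) ord0 +
                           \sum_j G (lift ord0 i) (lift ord0 j))); last first.
  by move=> i _; exact: (row (lift ord0 i)).
rewrite big_split /= IH // addr0 -big_split big1 // => i _; exact: GA.
Qed.

Section Koszul.
Variables (R : comPzRingType) (n r : nat).
Local Notation ext_series := (@ext_series R n r).

Lemma clifford_sq b V i (u : ext_series V) : clifford b i (clifford b i u) = 0.
Proof.
apply/funext => S; apply/funext => a; rewrite /clifford in_toggle eqxx addbT.
by case: (i \in S); case: b; rewrite ?scaler0.
Qed.

(** Multiplication by the linear form sum_j w_j x_j. *)
Definition var_comb (V : lmodType R) (w : 'I_r -> R) (u : ext_series V) : ext_series V :=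
  \sum_j w j *: shift U_(j)%MM u.

Lemma var_combE V w (u : ext_series V) :
  var_comb w u = \sum_j w j *: shift U_(j)%MM u.
Proof. by []. Qed.

Lemma var_comb_linear V w : linear (@var_comb V w).
Proof.
move=> c u v; rewrite /var_comb scaler_sumr -big_split; apply: eq_bigr => j _ /=.
by rewrite linearP scalerDr !scalerA mulrC.
Qed.
HB.instance Definition _ V w :=
  GRing.isLinear.Build R (ext_series V) (ext_series V) _ _ (@var_comb_linear V w).

Lemma var_comb_clifford V w b i (u : ext_series V) :
  clifford b i (var_comb w u) = var_comb w (clifford b i u).
Proof.
rewrite linear_sum; apply: eq_bigr => j _.
by rewrite linearZ /= shift_clifford.
Qed.

Lemma var_comb_shift V w e (u : ext_series V) :
  shift e (var_comb w u) = var_comb w (shift e u).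
Proof.
by rewrite linear_sum; apply: eq_bigr => j _; rewrite linearZ /= shiftC.
Qed.

Lemma map_coef_var_comb (V W : lmodType R) (h : {linear V -> W}) w (u : ext_series V) :
  map_coef h (var_comb w u) = var_comb w (map_coef h u).
Proof.
by rewrite linear_sum; apply: eq_bigr => j _; rewrite linearZ /= map_coef_shift.
Qed.

Lemma var_combC V w w' (u : ext_series V) :
  var_comb w (var_comb w' u) = var_comb w' (var_comb w u).
Proof.
transitivity (\sum_j w j *: var_comb w' (shift U_(j)%MM u)).
  by rewrite var_combE; apply: eq_bigr => j _; rewrite var_comb_shift.
by rewrite (var_combE w u) linear_sum; apply: eq_bigr => j _; rewrite linearZ.
Qed.

Lemma var_comb_suml V (I : Type) (s : seq I) (a : I -> R) (w : I -> 'I_r -> R)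
    (u : ext_series V) :
  \sum_(i <- s) a i *: var_comb (w i) u =
  var_comb (fun j => \sum_(i <- s) a i * w i j) u.
Proof.
rewrite /var_comb; under eq_bigr do rewrite scaler_sumr.
rewrite exchange_big; apply: eq_bigr => j _; rewrite scaler_suml.
by apply: eq_bigr => i _; rewrite scalerA.
Qed.

Variables (t : 'I_n -> R) (q : 'I_r -> 'I_n -> 'I_n -> R).

(** The coefficient c_ji of the factorization sum_i t_i c_ji of c_j, where
    q j i m stands for c_jim. *)
Definition half_coef (i : 'I_n) (j : 'I_r) : R := \sum_m t m * q j i m.

(** The square of this operator is multiplication by the potential
    sum_j x_j c_j. *)
Definition koszul (V : lmodType R) (u : ext_series V) : ext_series V :=
  \sum_i t i *: clifford false i u + \sum_i var_comb (half_coef i) (clifford true i u).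

Lemma koszul_at (V : lmodType R) (u : ext_series V) S a :
  koszul u S a = \sum_i t i *: clifford false i u S a +
    \sum_i \sum_j half_coef i j *: shift U_(j)%MM (clifford true i u) S a.
Proof.
rewrite /koszul !fctE !fct_sumE; congr (_ + _); apply: eq_bigr => i _.
by rewrite var_combE !fct_sumE.
Qed.

Lemma koszul_linear V : linear (@koszul V).
Proof.
move=> c u v; rewrite /koszul scalerDr addrACA.
congr (_ + _); rewrite scaler_sumr -big_split; apply: eq_bigr => i _ /=.
  by rewrite linearP scalerDr !scalerA mulrC.
by rewrite !linearP.
Qed.
HB.instance Definition _ V :=
  GRing.isLinear.Build R (ext_series V) (ext_series V) _ _ (@koszul_linear V).

Lemma map_coef_koszul (V W : lmodType R) (h : {linear V -> W}) (u : ext_series V) :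
  map_coef h (koszul u) = koszul (map_coef h u).
Proof.
rewrite linearD !linear_sum; congr (_ + _); apply: eq_bigr => i _.
  by rewrite linearZ /= map_coef_clifford.
by rewrite /= map_coef_var_comb map_coef_clifford.
Qed.

Lemma shift_koszul V e (u : ext_series V) : shift e (koszul u) = koszul (shift e u).
Proof.
rewrite linearD !linear_sum; congr (_ + _); apply: eq_bigr => i _.
  by rewrite linearZ /= shift_clifford.
by rewrite /= var_comb_shift shift_clifford.
Qed.

Lemma var_comb_koszul V w (u : ext_series V) :
  var_comb w (koszul u) = koszul (var_comb w u).
Proof.
rewrite /var_comb linear_sum; apply: eq_bigr => j _.
by rewrite shift_koszul linearZ.
Qed.

Lemma anticommutator_clifford_koszul b V i (u : ext_series V) :
  clifford b i (koszul u) + koszul (clifford b i u) =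
  if b then t i *: u else var_comb (half_coef i) u.
Proof.
rewrite /koszul linearD addrACA !linear_sum.
have -> : \sum_j clifford b i (t j *: clifford false j u) +
    \sum_j t j *: clifford false j (clifford b i u) = if b then t i *: u else 0.
  rewrite -big_split (bigD1 i) //= big1 => [|j]; last rewrite eq_sym => /negPf ij;
    rewrite linearZ /= -scalerDr cliffordC ?eqxx ?ij ?addr0 ?scaler0 //.
  by case: b; rewrite ?scaler0.
have -> : \sum_j clifford b i (var_comb (half_coef j) (clifford true j u)) +
    \sum_j var_comb (half_coef j) (clifford true j (clifford b i u)) =
    if b then 0 else var_comb (half_coef i) u.
  rewrite -big_split (bigD1 i) //= big1 => [|j]; last rewrite eq_sym => /negPf ij;
    rewrite var_comb_clifford -linearD cliffordC ?eqxx ?ij ?addr0 ?linear0 //.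
  by case: b; rewrite ?linear0.
by case: b; rewrite ?addr0 ?add0r.
Qed.

Hypothesis potential0 : forall j, \sum_i t i * half_coef i j = 0.

(** The contraction part and the multiplication part square to zero since
    their terms anticommute and their coefficients commute; the cross terms
    add up to the potential. *)
Lemma koszul_sq V (u : ext_series V) : koszul (koszul u) = 0.
Proof.
have mixed : \sum_i t i *: clifford false i (koszul u) +
    \sum_i t i *: koszul (clifford false i u) = 0.
  rewrite -big_split /=.
  under eq_bigr do rewrite -scalerDr anticommutator_clifford_koszul.
  rewrite var_comb_suml /var_comb big1 // => j _.
  by rewrite potential0 scale0r.
have sq0 : \sum_i \sum_j t i *: (t j *: clifford false j (clifford false i u)) = 0.
  apply: sum_alternating => [i|i j]; first by rewrite clifford_sq !scaler0.
  by rewrite !scalerA mulrC -scalerDr cliffordC andbF scaler0.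
have sq1 : \sum_i \sum_j var_comb (half_coef j)
    (clifford true j (var_comb (half_coef i) (clifford true i u))) = 0.
  apply: sum_alternating => [i|i j].
    by rewrite var_comb_clifford clifford_sq !linear0.
  by rewrite !var_comb_clifford var_combC -!linearD cliffordC andbF !linear0.
have E1 : \sum_i t i *: koszul (clifford false i u) =
    \sum_i var_comb (half_coef i) (clifford true i (\sum_i t i *: clifford false i u)).
  transitivity (\sum_i \sum_j t i *: (t j *: clifford false j (clifford false i u)) +
    \sum_i \sum_j t i *: var_comb (half_coef j) (clifford true j (clifford false i u))).
    rewrite -big_split; apply: eq_bigr => i _ /=.
    by rewrite /koszul scalerDr !scaler_sumr.
  rewrite sq0 add0r exchange_big; apply: eq_bigr => i _ /=.
  rewrite !linear_sum /=; apply: eq_bigr => j _; by rewrite !linearZ.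
rewrite {1}/koszul -[RHS]mixed; congr (_ + _).
rewrite E1; apply/eqP; rewrite -subr_eq0 -sumrB.
rewrite (eq_bigr (fun i => \sum_j var_comb (half_coef i) (clifford true i
  (var_comb (half_coef j) (clifford true j u))))); last first.
  by move=> i _; rewrite -!linearB /= /koszul addrAC subrr add0r !linear_sum.
by rewrite exchange_big sq1.
Qed.

(** The correction term makes the contraction by e_i, whose anticommutator
    with the Koszul differential is sum_j x_j c_ji, anticommute with it. *)
Definition contraction (V : lmodType R) (i : 'I_n) (u : ext_series V) : ext_series V :=
  clifford false i u - \sum_m var_comb (fun j => q j i m) (clifford true m u).

Lemma contraction_linear V i : linear (@contraction V i).
Proof.
move=> c u v; rewrite /contraction linearP scalerBr addrACA -opprD; congr (_ - _).
rewrite scaler_sumr -big_split; apply: eq_bigr => m _ /=.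
by rewrite !linearP.
Qed.
HB.instance Definition _ V i :=
  GRing.isLinear.Build R (ext_series V) (ext_series V) _ _ (@contraction_linear V i).

Lemma map_coef_contraction (V W : lmodType R) (h : {linear V -> W}) i (u : ext_series V) :
  map_coef h (contraction i u) = contraction i (map_coef h u).
Proof.
rewrite linearB linear_sum /= map_coef_clifford; congr (_ - _); apply: eq_bigr => m _.
by rewrite /= map_coef_var_comb map_coef_clifford.
Qed.

Lemma contraction_koszul V i (u : ext_series V) :
  contraction i (koszul u) = - koszul (contraction i u).
Proof.
have kc : koszul (contraction i u) = koszul (clifford false i u) -
    \sum_m var_comb (fun j => q j i m) (koszul (clifford true m u)).
  rewrite linearB linear_sum; congr (_ - _); apply: eq_bigr => m _.
  by rewrite var_comb_koszul.
apply/eqP; rewrite -addr_eq0 kc /contraction addrACA.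
rewrite anticommutator_clifford_koszul -opprD -big_split subr_eq0 /=.
rewrite (eq_bigr (fun m => t m *: var_comb (fun j => q j i m) u)); last first.
  move=> m _; rewrite -linearD /= anticommutator_clifford_koszul.
  by rewrite linearZ.
by rewrite var_comb_suml.
Qed.

End Koszul.

(** * The total complex of a resolution and the Koszul factorization *)
Section Total.
Variables (R : comPzRingType) (M : lmodType R) (P : proj_resolution M) (n r : nat).
Local Notation ext_series := (@ext_series R n r).
Variables (t : 'I_n -> R) (q : 'I_r -> 'I_n -> 'I_n -> R).
Hypothesis potential0 : forall j, \sum_i t i * half_coef t q i j = 0.
Hypothesis tM0 : forall i (x : M), t i *: x = 0.
Hypothesis qM0 : forall j i m (x : M), q j i m *: x = 0.

Local Notation koszul := (koszul t q).
Local Notation contraction := (contraction q).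

Lemma var_comb_M0 w (u : ext_series M) : (forall j x, w j *: (x : M) = 0) -> var_comb w u = 0.
Proof.
move=> w0; rewrite var_combE big1 // => j _; apply/funext => S; apply/funext => a.
by rewrite !fctE w0.
Qed.

Lemma koszul_M0 (u : ext_series M) : koszul u = 0.
Proof.
rewrite /koszul !big1 ?addr0 // => i _.
  apply: var_comb_M0 => j x; rewrite /half_coef scaler_suml big1 // => m _.
  by rewrite -scalerA qM0 scaler0.
by apply/funext => S; apply/funext => a; rewrite !fctE tM0.
Qed.

Lemma contraction_M (u : ext_series M) i : contraction i u = clifford false i u.
Proof.
by rewrite /contraction big1 ?subr0 // => m _; apply: var_comb_M0.
Qed.

Definition chain : Type := forall p, ext_series (P p).

Definition total_d (z : chain) : chain :=
  fun p => map_coef (res_d P p) (z p.+1) + (-1) ^+ p *: koszul (z p).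

Lemma map_coef_comp0 (V W X : lmodType R) (g : W -> X) (h : V -> W) (u : ext_series V) :
  (forall x, g (h x) = 0) -> map_coef g (map_coef h u) = 0.
Proof. by move=> gh; apply/funext => S; apply/funext => a; exact: gh. Qed.

Lemma aug_d_0 x : res_aug P (res_d P 0 x) = 0.
Proof. by apply/res_exact0; exists x. Qed.

Lemma d_d_0 i x : res_d P i (res_d P i.+1 x) = 0.
Proof. by apply/res_exactS; exists x. Qed.

Lemma aug_total_d z : map_coef (res_aug P) (total_d z 0%N) = 0.
Proof.
rewrite linearD linearZ /= map_coef_comp0 ?add0r; last exact: aug_d_0.
by rewrite map_coef_koszul koszul_M0 scaler0.
Qed.

Lemma total_dB z z' p : total_d (fun i => z i - z' i) p = total_d z p - total_d z' p.
Proof. by rewrite /total_d !linearB /= opprD addrACA. Qed.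

(** In the grading where e_i has degree 1 and x_j has degree -2, with d the
    degree in the resolution, this says that u is homogeneous of degree 0. *)
Definition weight_at (V : lmodType R) d (u : ext_series V) : Prop :=
  forall (S : {set 'I_n}) a, (#|S| + d)%N <> (mdeg a).*2 -> u S a = 0.

Lemma card_toggle i (S : {set 'I_n}) :
  if i \in S then #|toggle i S|.+1 = #|S| else #|toggle i S| = #|S|.+1.
Proof.
case: ifP => iS.
  rewrite [in RHS](cardsD1 i) iS add1n; congr (_.+1); apply: eq_card => j.
  by rewrite in_toggle !inE; case: eqP => [->|]; rewrite ?iS ?addbF ?andbT.
rewrite -add1n -[X in (X + _)%N]/(nat_of_bool true) -(negbT iS) -cardsU1.
apply: eq_card => j; rewrite in_toggle !inE.
by case: eqP => [->|]; rewrite ?iS ?addbF.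
Qed.

Lemma weight_atD V d (u v : ext_series V) : weight_at d u -> weight_at d v -> weight_at d (u + v).
Proof. by move=> hu hv S a Sa; rewrite !fctE hu // hv // addr0. Qed.

Lemma weight_atZ V d c (u : ext_series V) : weight_at d u -> weight_at d (c *: u).
Proof. by move=> hu S a Sa; rewrite !fctE hu // scaler0. Qed.

Lemma weight_at_sum V d (I : Type) (s : seq I) (F : I -> ext_series V) :
  (forall i, weight_at d (F i)) -> weight_at d (\sum_(i <- s) F i).
Proof.
move=> hF; elim/big_ind: _ => // u v; exact: weight_atD.
Qed.

Lemma koszul_weight_at V d (u : ext_series V) : weight_at d u -> weight_at d.+1 (koszul u).
Proof.
move=> hu; apply: weight_atD; apply: weight_at_sum => i.
  apply: weight_atZ => S a Sa; rewrite /clifford; case: eqP => // iS.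
  rewrite hu ?scaler0 //; have := card_toggle i S; rewrite iS => ->.
  by rewrite addSnnS.
rewrite var_combE; apply: weight_at_sum => j; apply: weight_atZ => S a Sa.
rewrite /shift /clifford; case: ifP => // ja; case: eqP => // iS.
rewrite hu ?scaler0 // => e; apply: Sa; have := card_toggle i S; rewrite iS => <-.
rewrite addSnnS addnS addnS e -(submK ja) mdegD mdeg1 doubleD.
by rewrite (submK ja) addn2.
Qed.

(** Exactness of the resolution lets one choose the components of w one
    after the other, starting with 0; the product total complex puts no
    condition on the infinite family so obtained. *)
Lemma total_d_lift (y : chain) :
  (forall p, total_d y p = 0) -> map_coef (res_aug P) (y 0%N) = 0 ->
  exists w : chain, [/\ w 0%N = 0, forall p, total_d w p = y p &
    (forall p, weight_at p.+1 (y p)) -> forall p, weight_at p (w p)].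
Proof.
move=> y_cycle y_aug.
(* Choosing 0 over 0 keeps the components homogeneous. *)
pose next p (v : ext_series (P p)) : ext_series (P p.+1) := fun S a =>
  let x := (y p - (-1) ^+ p *: koszul v) S a in
  if x == 0 then 0 else xget 0 [set b | res_d P p b = x]%classic.
pose w := fix w p : ext_series (P p) := if p is p'.+1 then next p' (w p') else 0.
have next_d p v S a : (exists b, res_d P p b = (y p - (-1) ^+ p *: koszul v) S a) ->
    res_d P p (next p v S a) = (y p - (-1) ^+ p *: koszul v) S a.
  rewrite /next; case: eqP => [-> _|_ [b bE]]; first by rewrite linear0.
  by have := xgetI 0 (bE : [set b | res_d P p b = _]%classic b).
exists w; split=> // [p|y_hom].
  suff dw : map_coef (res_d P p) (w p.+1) = y p - (-1) ^+ p *: koszul (w p).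
    by rewrite /total_d dw subrK.
  elim: p => [|p IH]; apply/funext => S; apply/funext => a; apply: next_d.
    by apply/res_exact0; rewrite /= linear0 scaler0 subr0; have /(congr1 (fun u => u S a)) := y_aug.
  apply/res_exactS.
  rewrite -[LHS]/(map_coef (res_d P p) (y p.+1 - (-1) ^+ p.+1 *: koszul (w p.+1)) S a).
  have kk : koszul (y p - (-1) ^+ p *: koszul (w p)) = koszul (y p).
    by rewrite linearB linearZ /= koszul_sq // scaler0 subr0.
  rewrite linearB linearZ /= map_coef_koszul IH kk exprS mulN1r scaleNr opprK.
  by have /(congr1 (fun u => u S a)) := y_cycle p.
elim=> [|p IH] S a Sa //=; rewrite /next.
suff -> : (y p - (-1) ^+ p *: koszul (w p)) S a = 0 by rewrite eqxx.
rewrite -scaleNr; apply: weight_atD Sa; first exact: y_hom.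
by apply: weight_atZ; exact: koszul_weight_at.
Qed.

Definition unit_ext (V : lmodType R) (x : V) : ext_series V :=
  fun S a => if (S == finset.set0) && (a == 0%MM) then x else 0.

Lemma map_coef_unit (V W : lmodType R) (h : {linear V -> W}) x :
  map_coef h (unit_ext x) = unit_ext (h x) :> ext_series W.
Proof.
apply/funext => S; apply/funext => a; rewrite /map_coef /unit_ext.
by case: ifP; rewrite ?linear0.
Qed.

(** The homology class of x: correct the chain equal to a preimage of x in
    degree 0 by a chain whose boundary cancels its boundary. *)
Lemma cycle_lifting (x : M) : exists z : chain,
  [/\ forall p, total_d z p = 0, exists2 b, z 0%N = unit_ext b & res_aug P b = x &
      forall p, weight_at p (z p)].
Proof.
have [b bx] := @res_aug_surj _ _ P x.
pose z0 : chain := fun p => if p is 0%N then unit_ext b else 0.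
have z0_hom p : weight_at p (z0 p).
  case: p => [|p] S a //=; rewrite addn0 /unit_ext.
  by case: ifP => // /andP[/eqP-> /eqP->]; rewrite cards0 mdeg0.
have dz0 p : total_d z0 p = if p is 0%N then koszul (z0 0%N) else 0.
  rewrite /total_d linear0 add0r; case: p => [|p]; first by rewrite scale1r.
  by rewrite linear0 scaler0.
have [||w [w0 dw w_hom]] := total_d_lift (y := total_d z0).
- move=> p; rewrite -[LHS]/(map_coef _ (total_d z0 p.+1) + (-1) ^+ p *: koszul (total_d z0 p)).
  rewrite !dz0 linear0 add0r.
  by case: p => [|p]; rewrite ?koszul_sq ?linear0 ?scaler0.
- exact: aug_total_d.
exists (fun p => z0 p - w p); split=> [p||p].
- by rewrite total_dB dw subrr.
- by exists b; rewrite // w0 subr0.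
- apply: weight_atD; first exact: z0_hom.
  rewrite -scaleN1r; apply: weight_atZ; apply: w_hom => {}p; rewrite dz0.
  by case: p => // S a Sa; apply: koszul_weight_at Sa; exact: z0_hom.
Qed.

Definition bounded N (f : hom_family P) : Prop :=
  forall p s x, ~~ (s <= p <= s + N)%N -> f p s x = 0.

(** The bound N on the cohomological degrees in f cuts the sum over all p
    down to a finite one. *)
Definition act N (f : hom_family P) (z : chain) : chain :=
  fun s => \sum_(p < s + N.+1) map_coef (f p s) (z p).

(** The grading involution, which accounts for the sign in moving an element
    past the differential. *)
Definition twist (f : hom_family P) : hom_family P :=
  fun p s x => (-1) ^+ (p + s) *: f p s x.

Definition linear_pack (V W : lmodType R) (h : V -> W) (hl : linear h) : {linear V -> W} :=
  HB.pack h (GRing.isLinear.Build R V W _ h hl).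

(** The components of a cocycle are functions that satisfy the linearity
    predicate, so naturality of the operators is restated for those. *)
Section PlainLinear.
Variables (V W : lmodType R) (h : V -> W) (hl : linear h).
Implicit Type u : ext_series V.
Let H := linear_pack hl.

Lemma map_coef_linD u v : map_coef h (u + v) = map_coef h u + map_coef h v.
Proof. exact: (linearD (map_coef H)). Qed.

Lemma map_coef_linB u v : map_coef h (u - v) = map_coef h u - map_coef h v.
Proof. exact: (linearB (map_coef H)). Qed.

Lemma map_coef_linZ c u : map_coef h (c *: u) = c *: map_coef h u.
Proof. exact: (linearZ_LR (map_coef H)). Qed.

Lemma map_coef_lin_sum (I : Type) (e : seq I) (p : pred I) (F : I -> ext_series V) :
  map_coef h (\sum_(i <- e | p i) F i) = \sum_(i <- e | p i) map_coef h (F i).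
Proof. exact: (linear_sum (map_coef H)). Qed.

Lemma map_coef_lin_koszul u : map_coef h (koszul u) = koszul (map_coef h u).
Proof. exact: (map_coef_koszul t q H). Qed.

Lemma map_coef_lin_contraction i u : map_coef h (contraction i u) = contraction i (map_coef h u).
Proof. exact: (map_coef_contraction q H). Qed.

Lemma map_coef_lin_shift e u : map_coef h (shift e u) = shift e (map_coef h u).
Proof. exact: (map_coef_shift H). Qed.
End PlainLinear.

Lemma actB N f z z' s : hom_linear f ->
  act N f (fun i => z i - z' i) s = act N f z s - act N f z' s.
Proof.
move=> fl; rewrite -sumrB; apply: eq_bigr => p _.
exact: map_coef_linB (fl p s) _ _.
Qed.

Lemma map_coef_scale (V W : lmodType R) (c : R) (h : V -> W) (u : ext_series V) :
  map_coef (fun x => c *: h x) u = c *: map_coef h u.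
Proof. by []. Qed.

Lemma act_widen N f z s L : bounded N f -> (s + N < L)%N ->
  act N f z s = \sum_(p < L) map_coef (f p s) (z p).
Proof.
move=> fN sL; rewrite -addnS in sL.
rewrite /act (big_ord_widen _ (fun p => map_coef (f p s) (z p)) sL) [LHS]big_mkcond.
apply: eq_bigr => p _; case: ltnP => // sp; apply/funext => S; apply/funext => a.
by rewrite /map_coef fN // negb_and -!ltnNge -addnS sp orbT.
Qed.

Lemma sqr_sign (m : nat) : (-1) ^+ m * (-1) ^+ m = 1 :> R.
Proof. by rewrite -exprD -signr_odd oddD addbb. Qed.

(** The cocycle condition compares the resolution part of the differential on
    both sides; the Koszul part commutes with f up to the same sign. *)
Lemma total_d_act N f z s : is_cocycle f -> bounded N f ->
  total_d (act N (twist f) z) s = act N f (total_d z) s.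
Proof.
move=> [fl _ fd] fN; rewrite /total_d.
rewrite {1}/act addSn big_ord_recl.
have -> : map_coef (@twist f 0%N s.+1) (z 0%N) = 0.
  by apply/funext => S; apply/funext => a; rewrite /map_coef /twist fN // scaler0.
rewrite add0r /act !linear_sum -big_split /=.
apply: eq_bigr => p _.
rewrite (map_coef_linD (fl p s)); congr (_ + _).
  apply/funext => S; apply/funext => a; rewrite /map_coef /twist linearZ /= fd scalerA.
  rewrite addSn addnS !exprS !mulN1r opprK sqr_sign.
  by rewrite scale1r.
rewrite (map_coef_linZ (fl p s)) (map_coef_lin_koszul (fl p s)).
by rewrite map_coef_scale linearZ /= scalerA exprD mulrCA sqr_sign mulr1.
Qed.
End Total.

(** * The symbol of a cocycle *)
Section Character.
Variables (R : comPzRingType) (M : lmodType R) (P : proj_resolution M) (n r : nat).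
Local Notation ext_series := (@ext_series R n r).
Variables (t : 'I_n -> R) (q : 'I_r -> 'I_n -> 'I_n -> R).
Hypothesis potential0 : forall j, \sum_i t i * half_coef t q i j = 0.
Hypothesis tM0 : forall i (x : M), t i *: x = 0.
Hypothesis qM0 : forall j i m (x : M), q j i m *: x = 0.

Local Notation koszul := (koszul t q).
Local Notation contraction := (contraction q).
Local Notation total_d := (@total_d R M P n r t q).
Local Notation chain := (@chain R M P n r).
Implicit Types (f g : cocycle P) (z y w : chain).

Lemma twist_cocycle (f : hom_family P) : is_cocycle f -> is_cocycle (twist f).
Proof.
move=> [fl [N fN] fd]; split=> [p s c x y||p s x].
- by rewrite /twist fl scalerDr !scalerA mulrC.
- by exists N => p s x /fN fx; rewrite /twist fx scaler0.
- by rewrite /twist linearZ /= fd !scalerA addSn addnS !exprS !mulN1r opprK.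
Qed.

Lemma twist_bounded N (f : hom_family P) : bounded N f -> bounded N (twist f).
Proof. by move=> fN p s x ps; rewrite /twist fN // scaler0. Qed.

Lemma twistK (f : hom_family P) : twist (twist f) = f.
Proof.
apply: functional_extensionality_dep => p; apply: functional_extensionality_dep => s.
by apply/funext => x; rewrite /twist scalerA sqr_sign scale1r.
Qed.

Lemma act_cycle N f z : bounded N f -> (forall p, total_d z p = 0) ->
  forall p, total_d (act N f z) p = 0.
Proof.
move=> fN zc p; rewrite -[X in act N X]twistK.
rewrite total_d_act; [|exact: twist_cocycle (cocycleP f)|exact: twist_bounded].
rewrite /act big1 // => i _; rewrite zc.
have [tl _ _] := twist_cocycle (cocycleP f).
by rewrite -(subrr 0) (map_coef_linB (tl i p)) subrr.
Qed.

(** A cycle of class 0 is a boundary, and cocycles preserve boundaries. *)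
Lemma aug_act_exact N (f : hom_family P) y : is_cocycle f -> bounded N f ->
  (forall p, total_d y p = 0) -> map_coef (res_aug P) (y 0%N) = 0 ->
  map_coef (res_aug P) (act N f y 0%N) = 0.
Proof.
move=> fc fN yc ya.
have [w [_ dw _]] := total_d_lift potential0 yc ya.
have -> : y = total_d w by apply: functional_extensionality_dep.
by rewrite -total_d_act // aug_total_d.
Qed.

(** The corrected contractions take z to a cycle of class 0, hence also f z;
    on homology they are the contractions. *)
Lemma aug_act_support N f z (S : {set 'I_n}) a : bounded N f ->
  (forall p, total_d z p = 0) ->
  (forall i, clifford false i (map_coef (res_aug P) (z 0%N)) = 0) ->
  S != finset.set0 -> map_coef (res_aug P) (act N f z 0%N) S a = 0.
Proof.
move=> fN zc z0 /set0Pn[i iS].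
pose y : chain := fun p => (-1) ^+ p *: contraction i (z p).
have yc p : total_d y p = 0.
  rewrite /total_d /y !linearZ /= map_coef_contraction exprS mulN1r scaleNr.
  rewrite -scalerN -scalerDr.
  have -> : (-1) ^+ p *: koszul (contraction i (z p)) =
     - contraction i ((-1) ^+ p *: koszul (z p)).
    by rewrite linearZ /= contraction_koszul scalerN opprK.
  by rewrite -opprD -linearD -/(total_d z p) zc linear0 oppr0 scaler0.
have ya : map_coef (res_aug P) (y 0%N) = 0.
  by rewrite /y scale1r map_coef_contraction contraction_M // z0.
have fz0 : clifford false i (map_coef (res_aug P) (act N f z 0%N)) = 0.
  have := aug_act_exact (twist_cocycle (cocycleP f)) (twist_bounded fN) yc ya.
  rewrite -(contraction_M qM0) -map_coef_contraction => <-; congr (map_coef _ _).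
  rewrite /act linear_sum; apply: eq_bigr => p _ /=.
  have fl := @cocycle_linear _ _ _ f p 0.
  rewrite /twist map_coef_scale /y (map_coef_linZ fl) scalerA addn0 sqr_sign scale1r.
  by rewrite (map_coef_lin_contraction _ fl).
have := congr1 (fun u : ext_series M => u (toggle i S) a) fz0.
rewrite /clifford in_toggle iS eqxx toggleK /= => /(congr1 (fun x => (-1) ^+ inversions i (toggle i S) *: x)).
by rewrite scalerA sqr_sign scale1r scaler0.
Qed.

Lemma act_mul N N' f g z : bounded N f -> bounded N' g ->
  bounded (N + N') (coc_mul f g) /\
  act (N + N') (coc_mul f g) z 0%N = act N f (act N' g z) 0%N.
Proof.
move=> fN gN; split.
  move=> p s x ps /=; apply: big1 => m _.
  have [mq|/fN->//] := boolP (s <= m <= s + N)%N.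
  have [pm|/gN->] := boolP (m <= p <= m + N')%N; last exact: cocycle0.
  case/negP: ps; case/andP: mq => qm mq; case/andP: pm => mp pm.
  by rewrite (leq_trans qm mp) /= (leq_trans pm) // addnA leq_add2r.
set L := (N + N').+1.
transitivity (\sum_(p < L) \sum_(m < L) map_coef (f m 0) (map_coef (g p m) (z p))).
  rewrite /act add0n; apply: eq_bigr => p _.
  apply/funext => S; apply/funext => a; rewrite /map_coef fct_sumE fct_sumE /=.
  rewrite (big_ord_widen _ (fun m => f m 0 (g p m (z p S a))) (ltn_ord p)).
  rewrite big_mkcond; apply: eq_bigr => m _; case: ltnP => // pm.
  by rewrite (cocycle_gt g) // cocycle0.
rewrite (act_widen (L := L) _ fN) ?add0n ?ltnS ?leq_addr //.
rewrite exchange_big; apply: eq_bigr => m _ /=.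
have [mN|mN] := leqP m N.
  rewrite (act_widen (L := L) _ gN) ?ltnS ?leq_add2r //.
  by rewrite (map_coef_lin_sum (@cocycle_linear _ _ _ f m 0)).
rewrite big1 => [|p _]; apply/funext => S; apply/funext => a;
  by rewrite /map_coef fN // add0n -ltnNge.
Qed.

(** The augmentation kills the part of the coboundary of h that ends with the
    differential of the resolution.  On a cycle z the other part is h applied
    to a multiple of the Koszul differential, which commutes with h and
    vanishes after augmentation. *)
Lemma aug_coboundary f z (S : {set 'I_n}) a p : coboundaries f ->
  (forall p, total_d z p = 0) -> res_aug P (f p 0 (z p S a)) = 0.
Proof.
move=> [h [hl _ fE]] zc; rewrite fE /hom_differential linearD aug_d_0 add0r.
case: p => [|p]; first by rewrite linear0.
have := zc p; rewrite /total_d => /eqP; rewrite addr_eq0 => /eqP.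
move=> /(congr1 (fun u : ext_series _ => u S a)); rewrite {1}/map_coef => ->.
rewrite linearZ /=.
have -> : h p 0 ((- ((-1) ^+ p *: koszul (z p))) S a) =
          map_coef (h p 0) (- ((-1) ^+ p *: koszul (z p))) S a by [].
rewrite -scaleNr (map_coef_linZ (hl p 0)) (map_coef_lin_koszul _ _ (hl p 0)).
rewrite -[res_aug P _]/(map_coef (res_aug P) (_ *: koszul (map_coef (h p 0) (z p))) S a).
by rewrite linearZ /= map_coef_koszul koszul_M0 // scaler0 scaler0.
Qed.

(** M is now a line over k with basis e and coordinate kappa, and z is a
    homogeneous cycle of class e. *)
Variables (k : fieldType) (iota : {rmorphism k -> R}) (kappa : M -> k) (e : M).
Hypothesis kappaB : zmod_morphism kappa.
Hypothesis kappaZ : forall c x, kappa (iota c *: x) = c * kappa x.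
Hypothesis kappa_e : kappa e = 1.
Hypothesis kappaK : forall x, iota (kappa x) *: e = x.
Variable z : chain.
Hypothesis z_cycle : forall p, total_d z p = 0.
Hypothesis z_aug : map_coef (res_aug P) (z 0%N) = unit_ext e.
Hypothesis z_hom : forall p, weight_at p (z p).

(** By homogeneity, 2|a| is the only degree of the resolution in which z has
    a component at the empty set and x^a. *)
Definition symbol_coef f (a : 'X_{1..r}) : k :=
  kappa (res_aug P (f (mdeg a).*2 0 (z (mdeg a).*2 finset.set0 a))).

Lemma kappa0 : kappa 0 = 0.
Proof. by rewrite -(subrr 0) kappaB subrr. Qed.

Lemma symbol_coef_act N f a : bounded N f ->
  map_coef (res_aug P) (act N f z 0%N) finset.set0 a = iota (symbol_coef f a) *: e.
Proof.
move=> fN; rewrite kappaK.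
have [L aL LN] : exists2 L, ((mdeg a).*2 < L)%N & (0 + N < L)%N.
  by exists ((mdeg a).*2 + N).+1; rewrite ltnS ?leq_addr ?leq_addl.
rewrite (act_widen (L := L) _ fN) // [LHS]/map_coef fct_sumE fct_sumE (bigD1 (Ordinal aL)) //=.
rewrite big1 ?addr0 // => p pa; rewrite /map_coef (z_hom (p := p)) ?cocycle0 //.
by rewrite cards0 add0n => pE; case/negP: pa; apply/eqP/val_inj.
Qed.

Lemma symbol_exists f : exists p : {mpoly k[r]}, forall a, p@_a = symbol_coef f a.
Proof.
have [N fN] : exists N, bounded N f by case: (cocycleP f).
exists (\sum_(m : 'X_{1..r < N.+1}) symbol_coef f m *: 'X_[m]) => a.
rewrite raddf_sum /=.
have [aN|Na] := ltnP (mdeg a) N.+1; last first.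
  rewrite big1 => [|m _].
    rewrite /symbol_coef fN ?linear0 ?kappa0 // add0n /= -ltnNge.
    by rewrite (leq_trans Na) // -addnn leq_addr.
  rewrite mcoeffZ mcoeffX; case: eqP => [ma|]; rewrite ?mulr0 //.
  by have := bmdeg m; rewrite ma ltnNge Na.
rewrite (bigD1 (BMultinom aN)) //= mcoeffZ mcoeffX eqxx mulr1 big1 ?addr0 // => m ma.
rewrite mcoeffZ mcoeffX; case: eqP => [E|]; rewrite ?mulr0 //.
by case/negP: ma; apply/eqP/val_inj.
Qed.

Lemma kappa_sum (I : Type) (s : seq I) (F : I -> M) :
  kappa (\sum_(i <- s) F i) = \sum_(i <- s) kappa (F i).
Proof.
apply: (big_morph kappa _ kappa0) => x y.
have kappaN : kappa (- y) = - kappa y by rewrite -[- y]sub0r kappaB kappa0 sub0r.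
by rewrite -{1}[y]opprK kappaB kappaN opprK.
Qed.

Lemma mcoeffXM (p : {mpoly k[r]}) (b a : 'X_{1..r}) :
  ('X_[b] * p)@_a = if (b <= a)%MM then p@_(a - b) else 0.
Proof.
case: ifP => ba.
  by have := mcoeffMX p b (a - b); rewrite addmC submK // mulrC.
rewrite [p]mpolyE mulr_sumr raddf_sum big1 // => m _ /=.
rewrite -scalerAr mcoeffZ -mpolyXD mcoeffX; case: eqP => [E|]; rewrite ?mulr0 //.
by case/negP: (negbT ba); rewrite -E lem_addr.
Qed.

Definition symbol f : {mpoly k[r]} := projT1 (cid (symbol_exists f)).

Lemma symbolE f a : (symbol f)@_a = symbol_coef f a.
Proof. exact: projT2 (cid (symbol_exists f)) a. Qed.

Lemma symbolB : zmod_morphism symbol.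
Proof.
move=> f g; apply/mpolyP => a; rewrite mcoeffB !symbolE.
by rewrite /symbol_coef -kappaB -linearB.
Qed.

Lemma symbol_scalar c : symbol (coc_scalar P (iota c)) = c%:MP.
Proof.
apply/mpolyP => a; rewrite symbolE mcoeffC /symbol_coef /= linearZ /= kappaZ.
congr (_ * _); have [<-|a0] := eqVneq 0%MM a.
  rewrite mdeg0 id_componentE.
  have := congr1 (fun u : ext_series M => u finset.set0 0%MM) z_aug.
  by rewrite /map_coef /unit_ext !eqxx /= => ->.
by rewrite id_component0 ?linear0 ?kappa0 // double_eq0 mdeg_eq0 eq_sym.
Qed.

Lemma shift_unit (V : lmodType R) (x : V) b (S : {set 'I_n}) (a : 'X_{1..r}) :
  shift b (unit_ext x : ext_series V) S a = if (S == finset.set0) && (b == a) then x else 0.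
Proof.
rewrite /shift /unit_ext; have [ba|ba] := boolP (b <= a)%MM; last first.
  by case: eqP => //= _; case: eqP => // E; case/negP: ba; rewrite E lepm_refl.
have -> // : (a - b == 0)%MM = (b == a).
apply/eqP/eqP => [E|->]; last by apply/mnmP => i; rewrite mnmBE subnn mnm0E.
by rewrite -(submK ba) E add0m.
Qed.

Lemma clifford_unit (V : lmodType R) (x : V) i :
  clifford false i (unit_ext x : ext_series V) = 0.
Proof.
apply/funext => S; apply/funext => a; rewrite /clifford /unit_ext.
case: eqP => // iS; case: eqP => [/setP/(_ i)|_]; rewrite ?scaler0 //.
by rewrite in_toggle iS eqxx inE.
Qed.

(** In homology g z = (symbol g) z, so f (g z) = (symbol g) (f z), and the
    class of f z is symbol f. *)
Lemma symbolM f g : symbol (coc_mul f g) = symbol f * symbol g.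
Proof.
have [N fN] : exists N, bounded N f by case: (cocycleP f).
have [N' gN] : exists N, bounded N g by case: (cocycleP g).
have [fgN actfg] := act_mul z fN gN.
pose z' : chain := fun p => \sum_(b <- msupp (symbol g)) iota (symbol g)@_b *: shift b (z p).
have z'_cycle p : total_d z' p = 0.
  transitivity (\sum_(b <- msupp (symbol g)) iota (symbol g)@_b *: shift b (total_d z p)).
    rewrite /total_d /z' !linear_sum -big_split; apply: eq_bigr => b _ /=.
    rewrite [shift b (_ + _)]linearD [RHS]scalerDr; congr (_ + _).
      by rewrite linearZ /= map_coef_shift.
    rewrite [koszul (_ *: _)]linearZ [in RHS]linearZ /= shift_koszul.
    by rewrite !scalerA mulrC.
  by rewrite big1 // => b _; rewrite z_cycle linear0 scaler0.
pose y : chain := fun p => act N' g z p - z' p.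
have yc p : total_d y p = 0.
  by rewrite total_dB z'_cycle (act_cycle gN z_cycle) subrr.
have ya : map_coef (res_aug P) (y 0%N) = 0.
  rewrite linearB /=; apply/eqP; rewrite subr_eq0; apply/eqP.
  have -> : map_coef (res_aug P) (z' 0%N) =
      \sum_(b <- msupp (symbol g)) iota (symbol g)@_b *: shift b (unit_ext e).
    rewrite linear_sum; apply: eq_bigr => b _.
    by rewrite linearZ /= map_coef_shift z_aug.
  apply/funext => S; apply/funext => a; rewrite [in RHS]fct_sumE [in RHS]fct_sumE.
  under [RHS]eq_bigr do rewrite !fctE shift_unit.
  have [->|S0] := eqVneq S finset.set0; last first.
    rewrite big1 => [|b _]; last by rewrite scaler0.
    apply: aug_act_support gN z_cycle _ S0 => i.
    by rewrite z_aug clifford_unit.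
  rewrite (symbol_coef_act _ gN) -symbolE /=.
  have [ag|ag] := boolP (a \in msupp (symbol g)).
    rewrite (bigD1_seq a) ?msupp_uniq //= eqxx big1 ?addr0 // => b /negPf->.
    by rewrite scaler0.
  rewrite (memN_msupp_eq0 ag) rmorph0 scale0r big_seq big1 // => b bg.
  by case: eqP => [ba|]; rewrite ?scaler0 //; rewrite ba (negPf ag) in bg.
have := aug_act_exact (cocycleP f) fN yc ya.
rewrite actB ?linearB /=; last by case: (cocycleP f).
rewrite -actfg => /eqP; rewrite subr_eq0 => /eqP fgE.
apply/mpolyP => a; rewrite symbolE.
have := congr1 (fun u : ext_series M => kappa (u finset.set0 a)) fgE.
rewrite (symbol_coef_act _ fgN) kappaZ kappa_e mulr1 => ->.
have -> : act N f z' 0%N =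
    \sum_(b <- msupp (symbol g)) iota (symbol g)@_b *: shift b (act N f z 0%N).
  rewrite /act /z'; under [RHS]eq_bigr do rewrite linear_sum scaler_sumr.
  rewrite [RHS]exchange_big; apply: eq_bigr => p _ /=.
  have fl := @cocycle_linear _ _ _ f p 0.
  rewrite (map_coef_lin_sum fl); apply: eq_bigr => b _.
  by rewrite (map_coef_linZ fl) (map_coef_lin_shift fl).
have -> : symbol f * symbol g =
    \sum_(b <- msupp (symbol g)) (symbol g)@_b *: ('X_[b] * symbol f).
  rewrite mulrC [X in X * _]mpolyE mulr_suml.
  by apply: eq_bigr => b _; rewrite scalerAl.
rewrite linear_sum fct_sumE fct_sumE kappa_sum raddf_sum; apply: eq_bigr => b _ /=.
rewrite linearZ /= fctE fctE kappaZ mcoeffZ mcoeffXM; congr (_ * _).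
rewrite map_coef_shift /shift; case: ifP => _; last exact: kappa0.
by rewrite (symbol_coef_act _ fN) kappaZ kappa_e mulr1 symbolE.
Qed.

Lemma symbol_coboundary f : coboundaries f -> symbol f = 0.
Proof.
move=> fB; apply/mpolyP => a; rewrite symbolE mcoeff0 /symbol_coef.
by rewrite aug_coboundary // kappa0.
Qed.
End Character.

(** * Cocycles of degree two *)

(** The universal property of a projective module speaks of surjections, so a
    map with values in the image of d is lifted along d by way of the image
    as a module. *)
Section ImageModule.
Variables (R : pzRingType) (V W : lmodType R) (d : {linear V -> W}).

Definition in_image : {pred W} := fun w => `[< exists v, d v = w >].

Lemma in_image_submod : submod_closed in_image.
Proof.
split=> [|a x y /asboolP[v <-] /asboolP[w <-]]; apply/asboolP.
  by exists 0; rewrite linear0.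
by exists (a *: v + w); rewrite linearP.
Qed.

HB.instance Definition _ := GRing.isSubmodClosed.Build R W in_image in_image_submod.

Record image_module := ImageModule { image_val : W; _ : image_val \in in_image }.

HB.instance Definition _ := [isSub for image_val].
HB.instance Definition _ := [Choice of image_module by <:].
HB.instance Definition _ := [SubChoice_isSubLmodule of image_module by <:].

Lemma projective_lift (P : lmodType R) (f : {linear P -> W}) :
  projective P -> (forall x, exists v, d v = f x) ->
  exists h : {linear P -> V}, forall x, d (h x) = f x.
Proof.
move=> Pproj fd.
have dP v : d v \in in_image by apply/asboolP; exists v.
have fP x : f x \in in_image by apply/asboolP; exact: fd.
have dl : linear (fun v => ImageModule (dP v)).
  by move=> a v w; apply: val_inj; rewrite /= linearP.
have fl : linear (fun v => ImageModule (fP v)).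
  by move=> a v w; apply: val_inj; rewrite /= linearP.
pose D : {linear V -> image_module} := HB.pack (fun v => ImageModule (dP v))
  (GRing.isLinear.Build R V image_module _ _ dl).
pose F : {linear P -> image_module} := HB.pack (fun v => ImageModule (fP v))
  (GRing.isLinear.Build R P image_module _ _ fl).
have [|h hE] := Pproj _ _ D F.
  move=> [w wP]; case/asboolP: (wP) => v vw; exists v; apply: val_inj => /=.
  exact: vw.
by exists h => x; have /(congr1 val) := hE x.
Qed.
End ImageModule.

Section DegreeTwo.
Variables (R : comPzRingType) (M : lmodType R) (P : proj_resolution M).
Variable g : {linear P 2 -> M}.
Hypothesis g_cocycle : forall x, g (res_d P 2 x) = 0.

Let liftable s (h : {linear P s.+2 -> P s}) : Prop :=
  forall x, exists y, res_d P s y = h (res_d P s.+2 x).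

Lemma degree_two_base :
  exists h : {linear P 2 -> P 0}, liftable h /\ forall x, res_aug P (h x) = g x.
Proof.
have [h hE] := projective_lift (f := g) (d := res_aug P) (@res_projective _ _ P 2)
  (fun x => @res_aug_surj _ _ P (g x)).
by exists h; split=> // x; apply/res_exact0; rewrite hE g_cocycle.
Qed.

Lemma degree_two_step s (h : {linear P s.+2 -> P s}) : liftable h ->
  exists h' : {linear P s.+3 -> P s.+1}, liftable h' /\
    forall x, res_d P s (h' x) = h (res_d P s.+2 x).
Proof.
move=> hl.
have [h' h'E] := projective_lift (f := h \o res_d P s.+2) (d := res_d P s)
  (@res_projective _ _ P s.+3) hl.
by exists h'; split=> // x; apply/res_exactS; rewrite h'E /= d_d_0 linear0.
Qed.

(** The comparison theorem for resolutions: a map on the second syzygies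
    extends to a chain map of degree 2. *)
Lemma degree_two_lift : exists h : forall s, {linear P s.+2 -> P s},
  (forall x, res_aug P (h 0%N x) = g x) /\
  (forall s x, res_d P s (h s.+1 x) = h s (res_d P s.+2 x)).
Proof.
have [h0 [h0l h0E]] := degree_two_base.
pose T s := {h : {linear P s.+2 -> P s} | liftable h}.
pose next s (h : T s) : T s.+1 :=
  let c := cid (degree_two_step (projT2 h)) in exist _ (projT1 c) (projT2 c).1.
pose H := fix H s : T s := if s is s'.+1 then next s' (H s') else exist _ h0 h0l.
exists (fun s => projT1 (H s)); split=> // s x /=.
exact: (projT2 (cid (degree_two_step (projT2 (H s))))).2.
Qed.

Lemma degree_two_cocycle : exists f : cocycle P,
  (forall x, res_aug P (f 2 0 x) = g x) /\
  (forall p x, p != 2%N -> f p 0 x = 0).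
Proof.
have [h [h0 hS]] := degree_two_lift.
pose F : hom_family P := fun p s => match p return P p -> P s with
  | p'.+2 => fun x => id_component s (h p' x) | _ => fun=> 0 end.
have Fc : is_cocycle F.
  split=> [[|[|p]] s a x y|| [|[|p]] s x]; rewrite /F.
  - by rewrite scaler0 addr0.
  - by rewrite scaler0 addr0.
  - have := @cocycle_linear _ _ P (coc1 P) p s a (h p x) (h p y).
    by rewrite /= -linearP.
  - exists 2%N => -[|[|p]] s x //; case: (eqVneq p s) => [<-|ps].
      by rewrite addn2 leqnn !leqW.
    by rewrite id_component0.
  - by rewrite linear0 scaler0.
  - by rewrite id_component0 // linear0 scaler0.
  - have := @cocycle_d _ _ P (coc1 P) p s (h p.+1 x).
    by rewrite /= hS !addSn !exprS !mulN1r opprK.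
exists (Cocycle Fc); split=> [x|[|[|[|p]]] x //= _].
  by rewrite /= id_componentE h0.
by rewrite id_component0.
Qed.

End DegreeTwo.

(** For a cycle z with part b in degree 0, the component in degree 2 at x_l
    remembers the generator c_l: its boundary is sum_i t_i y_i, where
    d y_i = - c_li b. *)
Section LowDegree.
Variables (R : comPzRingType) (M : lmodType R) (P : proj_resolution M) (n r : nat).
Local Notation ext_series := (@ext_series R n r).
Variables (t : 'I_n -> R) (q : 'I_r -> 'I_n -> 'I_n -> R).
Local Notation koszul := (koszul t q).
Local Notation total_d := (@total_d R M P n r t q).
Variable z : @chain R M P n r.
Hypothesis z_cycle : forall p, total_d z p = 0.
Variable b : P 0%N.
Hypothesis z0E : z 0%N = unit_ext b.

Lemma inversions_low i (S : {set 'I_n}) : S \subset [set i]%SET -> inversions i S = 0%N.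
Proof.
move=> /fintype.subsetP Si; rewrite /inversions big1 // => j _.
by case: (boolP (j \in S)) => //= /Si; rewrite inE => /eqP->; rewrite ltnn.
Qed.

Lemma cycle_d2 l : res_d P 1 (z 2 finset.set0 U_(l)%MM) =
  \sum_i t i *: z 1 [set i]%SET U_(l)%MM.
Proof.
have := congr1 (fun u : ext_series _ => u finset.set0 U_(l)%MM) (z_cycle 1).
rewrite /total_d expr1 scaleN1r => /eqP; rewrite subr_eq0 => /eqP.
rewrite {1}/map_coef => ->; rewrite koszul_at [X in _ + X]big1.
  rewrite addr0; apply: eq_bigr => i _; rewrite /clifford inE.
  rewrite inversions_low ?finset.sub0set // scale1r.
  congr (t i *: z 1 _ _); apply/setP => j; by rewrite in_toggle !inE.
move=> i _; rewrite big1 // => j _.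
by rewrite /shift /clifford inE /=; case: ifP => _; rewrite scaler0.
Qed.

Lemma cycle_d1 i l : res_d P 0 (z 1 [set i]%SET U_(l)%MM) = - half_coef t q i l *: b.
Proof.
have := congr1 (fun u : ext_series _ => u [set i]%SET U_(l)%MM) (z_cycle 0).
rewrite /total_d expr0 scale1r => /eqP; rewrite addr_eq0 => /eqP.
rewrite {1}/map_coef => ->; rewrite scaleNr.
rewrite -[LHS]/(- (koszul (z 0%N) [set i]%SET U_(l)%MM)); congr (- _).
rewrite koszul_at big1.
  rewrite add0r (bigD1 i) //= [X in _ + X]big1; last first.
    move=> m mi; rewrite big1 // => j _.
    rewrite /shift /clifford inE (negPf mi) /=.
    by case: ifP => _; rewrite scaler0.
  rewrite addr0 (bigD1 l) //= big1.
    rewrite addr0 /shift lepm_refl /clifford inE eqxx /= z0E.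
    rewrite inversions_low // scale1r; congr (_ *: _); rewrite /unit_ext.
    case: ifP => // /negP[]; apply/andP; split.
      by apply/eqP/setP => j; rewrite in_toggle !inE addbb.
    by apply/eqP/mnmP => j; rewrite mnmBE subnn mnm0E.
  move=> j jl; rewrite /shift; case: ifP => [/mnm_lepP/(_ j)|]; rewrite ?scaler0 //.
  by rewrite !mnm1E eqxx eq_sym (negPf jl).
move=> m _; rewrite z0E /clifford; case: ifP => _; rewrite ?scaler0 //.
rewrite /unit_ext; case: ifP; rewrite ?scaler0 // => /andP[_ /eqP/mnmP/(_ l)].
by rewrite mnm1E mnm0E eqxx.
Qed.

End LowDegree.

(** * Relations among homogeneous generators *)
Section Vanishing.
Variables (k : fieldType) (n : nat).
Implicit Types f g : {mpoly k[n]}.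

Definition vanishes d f : Prop := forall m, (mdeg m < d)%N -> f@_m = 0.

(** Divide each monomial by one of the variables that occur in it. *)
Lemma vanishes_factor d f : vanishes d.+1 f ->
  exists g : 'I_n -> {mpoly k[n]},
    (forall i, vanishes d (g i)) /\ f = \sum_i 'X_i * g i.
Proof.
move=> fd; pose pk (m : 'X_{1..n}) := [pick i | m i != 0%N].
exists (fun i => \sum_(m <- msupp f | pk m == Some i) f@_m *: 'X_[m - U_(i)]).
have pkP m i : pk m == Some i -> (U_(i) <= m)%MM.
  rewrite /pk; case: pickP => // j mj /eqP[<-]; apply/mnm_lepP => l.
  by rewrite mnm1E; case: eqP => // <-; rewrite lt0n.
split=> [i m md|].
  rewrite raddf_sum big_seq_cond big1 // => m' /andP[m'f pm'] /=.
  rewrite mcoeffZ mcoeffX; case: eqP => [E|]; rewrite ?mulr0 // fd ?mul0r //.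
  by rewrite -(submK (pkP _ _ pm')) E mdegD mdeg1 addn1.
rewrite [LHS]mpolyE.
under [RHS]eq_bigr do rewrite mulr_sumr big_mkcond.
rewrite exchange_big big_seq [RHS]big_seq; apply: eq_bigr => m mf /=.
have [i pm] : exists i, pk m = Some i.
  rewrite /pk; case: pickP => [i _|m0]; first by exists i.
  have mE : m = 0%MM by apply/mnmP => i; rewrite mnm0E; apply/eqP; rewrite -[_ == _]negbK m0.
  by move: mf; rewrite mcoeff_msupp fd ?eqxx // mE mdeg0.
rewrite -big_mkcond (big_pred1 i) => [|j]; last by rewrite pm eq_sym.
by rewrite -scalerAr -mpolyXD addmC submK // pkP // pm.
Qed.

Lemma dhomog_vanishes d e f : f \is d.-homog -> (e <= d)%N -> vanishes e f.
Proof.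
move=> fd ed m me; apply: (dhomog_nemf_coeff fd).
by rewrite neq_ltn (leq_trans me).
Qed.

Lemma mcoeff0_mul f g : (f * g)@_0%MM = f@_0%MM * g@_0%MM.
Proof. exact: rmorphM (mcoeff 0%MM) f g. Qed.

Lemma cubic_factor r (c : 'I_r -> {mpoly k[n]}) : (forall j, vanishes 3 (c j)) ->
  exists q : 'I_r -> 'I_n -> 'I_n -> {mpoly k[n]},
    (forall j i m, (q j i m)@_0%MM = 0) /\
    forall j, c j = \sum_i 'X_i * \sum_m 'X_m * q j i m.
Proof.
move=> c3.
have step j : exists q : 'I_n -> 'I_n -> {mpoly k[n]},
    (forall i m, (q i m)@_0%MM = 0) /\ c j = \sum_i 'X_i * \sum_m 'X_m * q i m.
  have [g [g2 ->]] := vanishes_factor (c3 j).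
  have [q qP] := choice (fun i => vanishes_factor (g2 i)).
  exists q; split=> [i m|]; first by apply: (qP i).1; rewrite mdeg0.
  by apply: eq_bigr => i _; rewrite -(qP i).2.
have [q qP] := choice step.
by exists q; split=> [j|j]; case: (qP j).
Qed.

Lemma pihomog_mul_dhomog d e f c : c \is e.-homog ->
  pihomog mdeg d (f * c) =
  (\sum_(m <- msupp f | (mdeg m + e == d)%N) f@_m *: 'X_[m]) * c.
Proof.
move=> ce; rewrite {1}[f]mpolyE mulr_suml linear_sum mulr_suml [RHS]big_mkcond.
apply: eq_bigr => m _; rewrite -scalerAl linearZ /=.
have mc : 'X_[m] * c \is (mdeg m + e).-homog by apply: dhomogM; rewrite ?dhomogX.
case: eqP => [<-|/eqP ne]; first by rewrite (pihomog_dE mc).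
by rewrite (pihomog_ne0 ne mc) scaler0.
Qed.

(** In the component of the relation of degree deg c_j, the coefficient of c_j
    is the constant term of a_j; if it were not zero, then c_j would be a
    combination of the other generators. *)
Lemma minimal_relation_const r (c : 'I_r -> {mpoly k[n]}) (a : 'I_r -> {mpoly k[n]}) j :
  (forall i, exists d, c i \is d.-homog) ->
  ~ (exists a, c j = \sum_(l < r | l != j) a l * c l) ->
  \sum_l a l * c l = 0 -> (a j)@_0%MM = 0.
Proof.
move=> ch cmin rel; have [//|aj0] := eqVneq (a j)@_0%MM 0.
have [d dP] := choice ch; case: cmin.
pose b l := \sum_(m <- msupp (a l) | (mdeg m + d l == d j)%N) (a l)@_m *: 'X_[m].
have bj : b j = ((a j)@_0%MM)%:MP.
  rewrite /b (eq_bigl (fun m => m == 0%MM)) => [|m].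
    rewrite (big_rem 0%MM) ?mcoeff_msupp //= eqxx big_seq_cond big1 => [|m].
      by rewrite addr0 mpolyX0 alg_mpolyC.
    by rewrite mem_rem_uniq ?msupp_uniq // !inE => /andP[/andP[/negPf->]].
  by rewrite -{2}[d j]add0n eqn_add2r mdeg_eq0.
have rel' : \sum_l b l * c l = 0.
  have := congr1 (pihomog mdeg (d j)) rel; rewrite linear0 linear_sum /= => E; rewrite -[RHS]E.
  by apply: eq_bigr => l _; rewrite (pihomog_mul_dhomog _ _ (dP l)).
exists (fun l => - ((a j)@_0%MM)^-1 *: b l).
move: rel'; rewrite (bigD1 j) //= bj => /eqP; rewrite addr_eq0 => /eqP E.
transitivity (((a j)@_0%MM)^-1 *: (((a j)@_0%MM)%:MP * c j)).
  by rewrite mul_mpolyC scalerA mulVf // scale1r.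
rewrite E scalerN scaler_sumr -sumrN; apply: eq_bigr => l _.
by rewrite scaleNr mulNr scalerAl.
Qed.

Section GeneratorCoefficient.
Variables (r : nat) (I : set {mpoly k[n]}) (c : 'I_r -> {mpoly k[n]}).
Hypothesis generates : forall f, I f <-> exists a, f = \sum_(j < r) a j * c j.
Hypothesis minimal : forall i, ~ exists a, c i = \sum_(j < r | j != i) a j * c j.
Hypothesis homogeneous : forall i, exists d, c i \is d.-homog.

(** The coordinate at c_j of the class of f in I / m I, where m is the
    maximal ideal of the origin. *)
Definition gen_coef j f : k :=
  if pselect (exists a, f = \sum_(j < r) a j * c j) is left h
  then (projT1 (cid h) j)@_0%MM else 0.

Lemma gen_coefE a j : gen_coef j (\sum_l a l * c l) = (a j)@_0%MM.
Proof.
rewrite /gen_coef; case: pselect => [h|[]]; last by exists a.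
case: (cid h) => a' /= E; apply/eqP; rewrite eq_sym -subr_eq0 -mcoeffB; apply/eqP.
apply: (minimal_relation_const (a := fun l => a l - a' l)) => //.
by under eq_bigr do rewrite mulrBl; rewrite sumrB -E subrr.
Qed.

Lemma gen_coefP j s f g : I f -> I g ->
  gen_coef j (s * f + g) = s@_0%MM * gen_coef j f + gen_coef j g.
Proof.
move=> /generates[a ->] /generates[b ->].
rewrite mulr_sumr -big_split /=.
under eq_bigr do rewrite mulrA -mulrDl.
by rewrite !gen_coefE mcoeffD mcoeff0_mul.
Qed.

Lemma gen_coef_gen j l : gen_coef j (c l) = (j == l)%:R.
Proof.
have -> : c l = \sum_i ((i == l)%:R : {mpoly k[n]}) * c i.
  rewrite (bigD1 l) //= eqxx mul1r big1 ?addr0 // => i /negPf->.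
  by rewrite mul0r.
rewrite gen_coefE; case: (j == l); by rewrite ?mcoeff0 // mcoeff1 eqxx.
Qed.

End GeneratorCoefficient.
End Vanishing.

Lemma ideal_gen_linear_comb (R : comPzRingType) n (t : 'I_n -> R) x :
  ideal_gen (range t) x -> exists v : 'I_n -> R, x = \sum_i t i * v i.
Proof.
move=> tx; apply: (tx [set x | exists v : 'I_n -> R, x = \sum_i t i * v i]%classic).
  split=> [|_ _ [v ->] [w ->]|a _ [v ->]].
  - by exists (fun=> 0); rewrite big1 // => i _; rewrite mulr0.
  - exists (fun i => v i + w i); rewrite -big_split.
    by apply: eq_bigr => i _; rewrite mulrDr.
  - suff h : exists w : 'I_n -> R, a * (\sum_i t i * v i) = \sum_i t i * w i.
      by split=> //; rewrite mulrC.
    exists (fun i => a * v i); rewrite mulr_sumr; apply: eq_bigr => i _.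
    by rewrite mulrCA.
move=> _ [i _ <-]; exists (fun j => (j == i)%:R).
rewrite (bigD1 i) //= eqxx mulr1 big1 ?addr0 // => j /negPf->.
by rewrite mulr0.
Qed.

(** Comparison of the resolution with the exact sequence R^n -> R -> M. *)
Section LowLifts.
Variables (R : comPzRingType) (M : lmodType R) (P : proj_resolution M) (n : nat).
Variables (t : 'I_n -> R) (res : R -> M).
Hypothesis res_linear : linear (res : R^o -> M).
Hypothesis res_surj : forall m, exists x, res x = m.
Hypothesis res_ker : forall x, res x = 0 -> exists v : 'I_n -> R, x = \sum_i t i * v i.

Let comb (v : 'I_n -> R^o) : R^o := \sum_i t i * v i.

Let comb_linear : linear comb.
Proof.
move=> a v w; rewrite /comb scaler_sumr -big_split; apply: eq_bigr => i _ /=.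
by rewrite mulrDr -[(a *: v) i]/(a * v i) mulrCA.
Qed.

Lemma low_lifts : exists (u0 : P 0%N -> R) (u1 : P 1%N -> 'I_n -> R),
  [/\ forall x, res (u0 x) = res_aug P x,
      forall x, \sum_i t i * u1 x i = u0 (res_d P 0 x),
      forall a x y, u0 (a *: x + y) = a * u0 x + u0 y &
      forall a x y i, u1 (a *: x + y) i = a * u1 x i + u1 y i].
Proof.
have [|u0 u0E] := projective_lift (d := linear_pack res_linear) (f := res_aug P)
  (@res_projective _ _ P 0).
  by move=> x; have [y yx] := res_surj (res_aug P x); exists y.
have [|u1 u1E] := projective_lift (d := linear_pack comb_linear)
  (f := u0 \o res_d P 0) (@res_projective _ _ P 1).
  move=> x /=; have [|v vE] := @res_ker (u0 (res_d P 0 x)).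
    by have := u0E (res_d P 0 x); rewrite aug_d_0.
  by exists v.
exists u0, u1; split=> [x|x|a x y|a x y i].
- exact: u0E.
- exact: u1E.
- by rewrite linearP.
- by rewrite linearP.
Qed.
End LowLifts.

(** * Coordinates on second syzygies *)

(** The quotient ring and the residue module are given by abstract surjections
    with prescribed kernels. *)
Section Coordinates.
Variables (k : fieldType) (n r : nat) (I : set {mpoly k[n]}).
Variable c : 'I_r -> {mpoly k[n]}.
Hypothesis idealI : two_sided_ideal I.
Hypothesis generates : forall f, I f <-> exists a, f = \sum_(j < r) a j * c j.
Hypothesis minimal : forall i, ~ exists a, c i = \sum_(j < r | j != i) a j * c j.
Hypothesis c_homogeneous : forall i, exists d, (3 <= d)%N /\ c i \is d.-homog.

Variables (R : comPzRingType) (pr : {rmorphism {mpoly k[n]} -> R}).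
Hypothesis pr_surj : forall x, exists f, pr f = x.
Hypothesis pr_ker : forall f, pr f = 0 <-> I f.
Variables (M : lmodType R) (residue : R -> M).
Hypothesis residue_linear : linear (residue : R^o -> M).
Hypothesis residue_surj : forall m, exists x, residue x = m.
Hypothesis residue_ker : forall x,
  residue x = 0 <-> exists v : 'I_n -> R, x = \sum_i pr 'X_i * v i.

Let res : {linear R^o -> M} := linear_pack residue_linear.

Lemma residueZ a x : residue (a * x) = a *: residue x.
Proof. exact: (linearZ_LR res). Qed.

Lemma residueB : zmod_morphism residue.
Proof. exact: (linearB res). Qed.

Lemma residue_pr_surj x : exists f, residue (pr f) = x.
Proof.
by have [y <-] := residue_surj x; have [f <-] := pr_surj y; exists f.
Qed.

Lemma pr_eq f g : pr f = pr g <-> I (f - g).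
Proof.
rewrite -pr_ker rmorphB; split=> [->|/eqP]; first by rewrite subrr.
by rewrite subr_eq0 => /eqP.
Qed.

Lemma c_vanishes j : vanishes 3 (c j).
Proof. by have [d [d3 dh]] := c_homogeneous j; exact: dhomog_vanishes dh d3. Qed.

Lemma ideal_const f : I f -> f@_0%MM = 0.
Proof.
move=> /generates[a ->]; rewrite raddf_sum big1 // => j _ /=.
by rewrite mcoeff0_mul (@c_vanishes j 0%MM) ?mdeg0 // mulr0.
Qed.

Lemma mcoeffX0 i : ('X_i : {mpoly k[n]})@_0%MM = 0.
Proof. by rewrite mcoeffX -mdeg_eq0 mdeg1. Qed.

Lemma pr_comb (a : 'I_n -> {mpoly k[n]}) :
  pr (\sum_i 'X_i * a i) = \sum_i pr 'X_i * pr (a i).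
Proof. by rewrite rmorph_sum; apply: eq_bigr => i _; rewrite rmorphM. Qed.

Lemma residue_const f g : residue (pr f) = residue (pr g) -> f@_0%MM = g@_0%MM.
Proof.
move=> /eqP; rewrite -subr_eq0 -residueB => /eqP/residue_ker[v vE].
apply/eqP; rewrite -subr_eq0 -mcoeffB.
have [w wE] := choice (fun i => pr_surj (v i)).
have Ifg : I (f - g - \sum_i 'X_i * w i).
  apply/pr_eq; rewrite pr_comb rmorphB vE.
  by apply: eq_bigr => i _; rewrite wE.
have -> : (f - g)@_0%MM = (\sum_i 'X_i * w i)@_0%MM.
  by apply/eqP; rewrite -subr_eq0 -mcoeffB (ideal_const Ifg).
rewrite raddf_sum big1 // => i _ /=.
by rewrite mcoeff0_mul mcoeffX0 mul0r.
Qed.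

Definition residue_val (x : M) : k := (projT1 (cid (residue_pr_surj x)))@_0%MM.

Lemma residue_valE f : residue_val (residue (pr f)) = f@_0%MM.
Proof. by rewrite /residue_val; case: cid => g /= /residue_const. Qed.

Definition scalar : k -> R := pr \o @mpolyC n k.
HB.instance Definition _ := GRing.RMorphism.on scalar.

Lemma residue_valB : zmod_morphism residue_val.
Proof.
move=> x y; have [f <-] := residue_pr_surj x; have [g <-] := residue_pr_surj y.
by rewrite -residueB -rmorphB !residue_valE mcoeffB.
Qed.

Lemma residue_val0 : residue_val 0 = 0.
Proof. by rewrite -(subrr 0) residue_valB subrr. Qed.

Lemma residue_valZ f x : residue_val (pr f *: x) = f@_0%MM * residue_val x.
Proof.
have [g <-] := residue_pr_surj x.
by rewrite -residueZ -rmorphM !residue_valE mcoeff0_mul.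
Qed.

Lemma residue_val1 : residue_val (residue 1) = 1.
Proof. by rewrite -(rmorph1 pr) residue_valE mcoeff1 eqxx. Qed.

Lemma residue_valK x : scalar (residue_val x) *: residue 1 = x.
Proof.
have [f <-] := residue_pr_surj x; rewrite residue_valE -residueZ mulr1.
apply/eqP; rewrite -subr_eq0 -residueB /scalar /= -rmorphB; apply/eqP/residue_ker.
have [|g [_ ->]] := @vanishes_factor _ _ 0 ((f@_0%MM)%:MP - f).
  move=> m; rewrite ltnS leqn0 mdeg_eq0 => /eqP->.
  by rewrite mcoeffB mcoeffC eqxx mulr1 subrr.
by exists (pr \o g); rewrite pr_comb.
Qed.

Lemma pr_kill f (x : M) : f@_0%MM = 0 -> pr f *: x = 0.
Proof.
move=> f0; rewrite -[LHS]residue_valK residue_valZ f0 mul0r rmorph0.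
by rewrite scale0r.
Qed.

Variable P : proj_resolution M.

Lemma residue_val_inj : injective residue_val.
Proof. by move=> x y xy; rewrite -[x]residue_valK xy residue_valK. Qed.

Let c_hom i : exists d, c i \is d.-homog.
Proof. by have [d [_ ?]] := c_homogeneous i; exists d. Qed.

(** Coordinates of I / m I do not see elements of m I. *)
Lemma gen_coef_maximal j (F : 'I_n -> {mpoly k[n]}) g :
  (forall i, I (F i)) -> I g ->
  I (\sum_i 'X_i * F i + g) /\
  gen_coef c j (\sum_i 'X_i * F i + g) = gen_coef c j g.
Proof.
move=> FI gI; have [I0 ID IM] := idealI.
elim: (index_enum 'I_n) => [|i s [IHI IHE]]; first by rewrite big_nil add0r.
rewrite big_cons -addrA; split; first by apply: ID => //; exact: (IM _ _ (FI i)).1.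
by rewrite (gen_coefP generates minimal c_hom) // mcoeffX0 mul0r add0r.
Qed.

Definition coord_lift (x : R) : {mpoly k[n]} := projT1 (cid (pr_surj x)).

Lemma coord_liftK x : pr (coord_lift x) = x.
Proof. exact: projT2 (cid (pr_surj x)). Qed.

Definition lift_comb (v : 'I_n -> R) : {mpoly k[n]} := \sum_i 'X_i * coord_lift (v i).

Lemma lift_comb_ideal v : \sum_i pr 'X_i * v i = 0 -> I (lift_comb v).
Proof.
move=> v0; apply/pr_ker; rewrite pr_comb -[RHS]v0.
by apply: eq_bigr => i _; rewrite coord_liftK.
Qed.

(** Changing the lifts of the v_i changes each of them by an element of I,
    and their combination by an element of m I. *)
Lemma gen_coef_lift_comb j (v : 'I_n -> R) (a : 'I_n -> {mpoly k[n]}) :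
  (forall i, pr (a i) = v i) -> I (\sum_i 'X_i * a i) ->
  gen_coef c j (lift_comb v) = gen_coef c j (\sum_i 'X_i * a i).
Proof.
move=> av Ia.
have diffI i : I (coord_lift (v i) - a i) by apply/pr_eq; rewrite coord_liftK av.
rewrite -(gen_coef_maximal j diffI Ia).2 -big_split; congr gen_coef.
by apply: eq_bigr => i _ /=; rewrite mulrBr subrK.
Qed.

Section DegreeTwoFunctional.
Variables (Q : 'I_r -> 'I_n -> 'I_n -> {mpoly k[n]}) (j : 'I_r).
Hypothesis cQ : forall l, c l = \sum_i 'X_i * \sum_m 'X_m * Q l i m.
Variables (y : 'I_n -> 'I_r -> P 1%N) (w : 'I_r -> P 2%N) (b : P 0%N).
Hypothesis dw : forall l, res_d P 1 (w l) = \sum_i pr 'X_i *: y i l.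
Hypothesis dy : forall i l,
  res_d P 0 (y i l) = - half_coef (fun i => pr 'X_i) (fun l i m => pr (Q l i m)) i l *: b.
Hypothesis aug_b : res_aug P b = residue 1.

(** The map sends y to the coordinate at c_j of - sum_m t_m (u_1 (d y))_m in
    I / m I, where u_1 is the lift of the resolution in degree 1.  For y = w_l
    one has sum_m t_m (u_1 (y_il))_m = - c_li u_0 (b) modulo I, and u_0 (b) has
    constant term 1, so that the sum is - c_l modulo m I. *)
Lemma degree_two_functional : exists g : {linear P 2%N -> M},
  (forall x, g (res_d P 2 x) = 0) /\
  forall l, residue_val (g (w l)) = (j == l)%:R.
Proof.
have [I0 ID IM] := idealI.
have [u0 [u1 [u0E u1E u0l u1l]]] := low_lifts P residue_linear residue_surj
  (fun x => (residue_ker x).1).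
have u00 : u0 0 = 0.
  by have := u0l (-1) 0 0; rewrite scaler0 addr0 mulN1r addNr.
have u10 i : u1 0 i = 0.
  by have := u1l (-1) 0 0 i; rewrite scaler0 addr0 mulN1r addNr.
have u1_sum i (a : 'I_n -> R) (x : 'I_n -> P 1%N) :
    u1 (\sum_m a m *: x m) i = \sum_m a m * u1 (x m) i.
  elim: (index_enum 'I_n) => [|m s IH]; first by rewrite !big_nil u10.
  by rewrite !big_cons u1l IH.
have LI x : I (lift_comb (u1 (res_d P 1 x))).
  by apply: lift_comb_ideal; rewrite u1E d_d_0 u00.
pose gam x := - gen_coef c j (lift_comb (u1 (res_d P 1 x))).
have gam_lin f x x' : gam (pr f *: x + x') = f@_0%MM * gam x + gam x'.
  rewrite /gam mulrN -opprD -(gen_coefP generates minimal c_hom) //; congr (- _).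
  pose a i := f * coord_lift (u1 (res_d P 1 x) i) + coord_lift (u1 (res_d P 1 x') i).
  have aE : \sum_i 'X_i * a i =
      f * lift_comb (u1 (res_d P 1 x)) + lift_comb (u1 (res_d P 1 x')).
    rewrite /lift_comb mulr_sumr -big_split; apply: eq_bigr => i _ /=.
    by rewrite mulrDr mulrCA.
  rewrite -aE; apply: gen_coef_lift_comb => [i|].
    by rewrite rmorphD rmorphM /= !coord_liftK linearP u1l.
  by rewrite aE; apply: ID => //; exact: (IM _ _ (LI x)).1.
pose g x : M := scalar (gam x) *: residue 1.
have gE x : residue_val (g x) = gam x.
  by rewrite /g /scalar /= residue_valZ residue_val1 mulr1 mcoeffC eqxx mulr1.
have g_lin : linear g.
  move=> a x x'; have [f <-] := pr_surj a; apply: residue_val_inj.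
  rewrite gE gam_lin -[g x']opprK -[- g x']sub0r !residue_valB.
  rewrite residue_valZ !gE.
  by rewrite residue_val0 sub0r opprK.
have gen0 : gen_coef c j 0 = 0.
  have := gen_coefP generates minimal c_hom j (-1) I0 I0.
  by rewrite mulr0 addr0 mcoeffN mcoeff1 eqxx mulN1r addNr.
exists (linear_pack g_lin); split=> [x|l].
  apply: residue_val_inj; rewrite [LHS]gE /gam d_d_0.
  rewrite (@gen_coef_lift_comb j _ (fun=> 0)) => [|i|].
  - rewrite big1 => [|i _]; last by rewrite mulr0.
    by rewrite gen0 oppr0 residue_val0.
  - by rewrite rmorph0 u10.
  - by rewrite big1 // => i _; rewrite mulr0.
rewrite [X in residue_val X]/= gE /gam dw.
set beta := coord_lift (u0 b).
have beta0 : beta@_0%MM = 1.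
  have <- : (1 : {mpoly k[n]})@_0%MM = 1 by rewrite mcoeff1 eqxx.
  apply: residue_const.
  by rewrite coord_liftK u0E aug_b rmorph1.
pose A i m := coord_lift (u1 (y i l) m).
(* F i measures how far the relation for y_il is from holding before
   reduction modulo I. *)
pose F i := \sum_m 'X_m * A i m + (\sum_m 'X_m * Q l i m) * beta.
have FI i : I (F i).
  apply/pr_ker; rewrite /F rmorphD rmorphM !pr_comb coord_liftK.
  under eq_bigr do rewrite coord_liftK.
  rewrite u1E dy -[_ *: b]addr0 u0l u00 addr0 mulNr.
  by rewrite addNr.
pose a m := \sum_i 'X_i * A i m.
have aE : \sum_m 'X_m * a m = \sum_i 'X_i * F i + (- beta * c l + 0).
  rewrite addr0 mulNr cQ mulrC mulr_suml -sumrB.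
  under eq_bigr do rewrite mulr_sumr.
  rewrite exchange_big; apply: eq_bigr => i _ /=.
  rewrite /F mulrDr mulrA addrK mulr_sumr.
  by apply: eq_bigr => m _; rewrite mulrCA.
have cI : I (c l).
  apply/generates; exists (fun i => (i == l)%:R).
  rewrite (bigD1 l) //= eqxx mul1r big1 ?addr0 // => i /negPf->.
  by rewrite mul0r.
have bI : I (- beta * c l + 0) by apply: ID => //; exact: (IM _ _ cI).1.
rewrite (@gen_coef_lift_comb j _ a) => [|i|].
- rewrite aE (gen_coef_maximal j FI bI).2.
  rewrite (gen_coefP generates minimal c_hom) // gen0 addr0 mcoeffN beta0.
  by rewrite mulN1r opprK (gen_coef_gen minimal c_hom).
- by rewrite u1_sum pr_comb; apply: eq_bigr => m _; rewrite coord_liftK.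
- by rewrite aE; exact: (gen_coef_maximal j FI bI).1.
Qed.
End DegreeTwoFunctional.

End Coordinates.

(** * Surjections of rings and closed immersions *)
Section QuotientMap.
Variables (A B : pzRingType) (S : set A) (phi : {rmorphism A -> B}).
Hypothesis phiS : forall x, S x -> phi x = 0.

Lemma quotient_map_wd x y : @qproj A S x = qproj S y -> phi x = phi y.
Proof.
move=> /qprojP h; apply/eqP; rewrite -subr_eq0 -rmorphB; apply/eqP.
apply: (h (fun z => phi z = 0)) => //; split=> [|u v u0 v0|a u u0].
- exact: rmorph0.
- by rewrite rmorphD u0 v0 addr0.
- by rewrite !rmorphM u0 mulr0 mul0r.
Qed.

Lemma quotient_map : exists psi : {rmorphism quotient_ring S -> B},
  forall x, psi (qproj S x) = phi x.
Proof.
pose psi (u : quotient_ring S) := phi (projT1 (cid (qproj_surj u))).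
have psiE x : psi (qproj S x) = phi x.
  by rewrite /psi; case: cid => y /= /quotient_map_wd.
have psiB : zmod_morphism psi.
  move=> u v; have [x <-] := qproj_surj u; have [y <-] := qproj_surj v.
  by rewrite -rmorphB !psiE rmorphB.
have psiM : monoid_morphism psi.
  split=> [|u v]; first by rewrite -(rmorph1 (qproj S)) psiE rmorph1.
  have [x <-] := qproj_surj u; have [y <-] := qproj_surj v.
  by rewrite -rmorphM !psiE rmorphM.
pose H : {rmorphism quotient_ring S -> B} := HB.pack psi
  (GRing.isZmodMorphism.Build _ _ psi psiB) (GRing.isMonoidMorphism.Build _ _ psi psiM).
by exists H.
Qed.
End QuotientMap.

Section ClosedImmersion.
Variables (A B : comPzRingType) (phi : {rmorphism A -> B}).

Lemma Spec_ext (C : comPzRingType) (p q : Spec C) : (forall x, p x <-> q x) -> p = q.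
Proof.
case: p q => [p pP] [q qP] /= pq; have E : p = q by apply/funext => x; apply/propext.
by move: qP; rewrite -E => qP; rewrite (Prop_irrelevance pP qP).
Qed.

Lemma preimage_prime (p : Spec B) : prime_ideal [set a | p (phi a)]%classic.
Proof.
case: (Spec_prime p) => [[p0 pD pM] p1 pP]; split=> [||a b /=].
- split=> [|x y|a x] /=; first by rewrite rmorph0.
    by rewrite rmorphD; exact: pD.
  by rewrite !rmorphM; exact: pM.
- by rewrite /= rmorph1.
- by rewrite rmorphM; exact: pP.
Qed.

Definition Spec_map (p : Spec B) : Spec A := MkSpec (preimage_prime p).

Section Stalk.
Variable p : Spec B.

Definition frac_map (x : fraction (Spec_map p)) : fraction p :=
  @Fraction B p (phi (numer x)) (phi (denom x)) (@denomP _ _ x).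

Lemma frac_map_wd x y : toloc x = toloc y -> toloc (frac_map x) = toloc (frac_map y).
Proof.
move=> /tolocP[u [pu e]]; apply/tolocP; exists (phi u); split=> //=.
by rewrite -!rmorphM e.
Qed.

Definition loc_map (u : localization (Spec_map p)) : localization p :=
  toloc (frac_map (projT1 (cid (toloc_surj u)))).

Lemma loc_mapE x : loc_map (toloc x) = toloc (frac_map x).
Proof. by rewrite /loc_map; case: cid => y /= /frac_map_wd. Qed.

Lemma toloc_eq (C : comPzRingType) (s : Spec C) (x y : fraction s) :
  numer x * denom y = numer y * denom x -> toloc x = toloc y.
Proof.
by move=> e; apply/tolocP; exists 1; rewrite e; split=> //; case: (Spec_prime s).
Qed.

Lemma loc_mapB : zmod_morphism loc_map.
Proof.
move=> u v; have [x <-] := toloc_surj u; have [y <-] := toloc_surj v.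
rewrite -[toloc x - _]/(loc_add (toloc x) (loc_opp (toloc y))).
rewrite -toloc_opp -toloc_add !loc_mapE.
rewrite -[RHS]/(loc_add (toloc _) (loc_opp (toloc _))) -toloc_opp -toloc_add.
by apply: toloc_eq => /=; rewrite rmorphD rmorphM rmorphM !rmorphN rmorphM.
Qed.

Lemma loc_mapM : monoid_morphism loc_map.
Proof.
split=> [|u v].
  rewrite -[LHS]/(loc_map (toloc (frac_of (Spec_map p) 1))) loc_mapE.
  by apply: toloc_eq => /=; rewrite rmorph1.
have [x <-] := toloc_surj u; have [y <-] := toloc_surj v.
rewrite -[toloc x * _]/(loc_mul (toloc x) (toloc y)).
rewrite -toloc_mul !loc_mapE -[RHS]/(loc_mul (toloc _) (toloc _)) -toloc_mul.
by apply: toloc_eq => /=; rewrite !rmorphM.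
Qed.

HB.instance Definition _ := GRing.isZmodMorphism.Build _ _ loc_map loc_mapB.
HB.instance Definition _ := GRing.isMonoidMorphism.Build _ _ loc_map loc_mapM.

Lemma loc_map_in a : loc_map (loc_in (Spec_map p) a) = loc_in p (phi a).
Proof.
by rewrite /loc_in loc_mapE; apply: toloc_eq => /=; rewrite rmorph1.
Qed.

Lemma loc_map_local x : invertible (loc_map x) -> invertible x.
Proof.
have [{}x <-] := toloc_surj x; rewrite loc_mapE => -[y [+ _]].
have [{}y <-] := toloc_surj y.
rewrite -[X in X = _]/(loc_mul (toloc _) (toloc _)) -toloc_mul.
rewrite -[X in _ = X]/(toloc (frac_of p 1)) => /tolocP[u [pu /=]].
rewrite !mulr1 mul1r => e.
have [[p0 pD pM] p1 pP] := Spec_prime p.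
have px : ~ Spec_map p (numer x).
  move=> px; have : p (u * (phi (denom x) * denom y)).
    by rewrite -e mulrA; apply: (pM _ _ _).2; apply: (pM _ _ _).1.
  case/pP => [//|/pP[|]]; first exact: (@denomP _ _ x).
  exact: denomP.
exists (toloc (@Fraction A (Spec_map p) (denom x) (numer x) px)).
have H : toloc x * toloc (@Fraction A (Spec_map p) (denom x) (numer x) px) = 1.
  rewrite -[LHS]/(loc_mul (toloc _) (toloc _)) -toloc_mul.
  by apply: toloc_eq => /=; ring.
by split=> //; rewrite mulrC.
Qed.

Lemma loc_map_surj : (forall b, exists a, phi a = b) -> forall y, exists x, loc_map x = y.
Proof.
move=> surj y; have [{}y <-] := toloc_surj y.
have [a aE] := surj (numer y); have [b bE] := surj (denom y).
have bp : ~ Spec_map p b by rewrite /= bE; exact: denomP.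
exists (toloc (@Fraction A (Spec_map p) a b bp)); rewrite loc_mapE.
by apply: toloc_eq => /=; rewrite aE bE.
Qed.
End Stalk.

Lemma Spec_map_continuous : continuous Spec_map.
Proof.
apply/continuousP => _ [S ->].
exists (phi @` S)%classic; apply/seteqP; split=> p /= Sp Sp'; apply: Sp.
  by move=> a Sa; apply: Sp'; exists a.
by move=> _ [a Sa <-]; exact: Sp'.
Qed.

Lemma Spec_map_section (U : set (Spec A)) s : open U -> is_section U s ->
  is_section (Spec_map @^-1` U)%classic (fun p => loc_map (s (Spec_map p))).
Proof.
move=> _ sU p Up; have [a [b ab]] := sU _ Up.
exists (phi a), (phi b).
apply: (@filterS _ (nbhs p) _ _ _ _ (Spec_map_continuous ab)) => q /= [bq sq].
by exists bq; rewrite sq loc_mapE.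
Qed.

Definition Spec_map_morphism : Spec_morphism B A :=
  SpecMorphism (stalk_map := fun p => loc_map (p := p)) Spec_map_continuous Spec_map_section loc_map_local.

Hypothesis phi_surj : forall b, exists a, phi a = b.

Lemma Spec_map_inj : injective Spec_map.
Proof.
move=> p q pq; apply: Spec_ext => b; have [a <-] := phi_surj b.
by rewrite -[p (phi a)]/(Spec_map p a) pq.
Qed.

Lemma Spec_map_closed (C : set (Spec B)) : closed C -> closed (Spec_map @` C)%classic.
Proof.
move=> /closed_openC [S CE].
have {}CE p : C p <-> (S `<=` p)%classic.
  have := congr1 (fun X : set _ => X p) CE; rewrite /setC /= => E.
  split=> [Cp|Sp]; apply: contrapT.
    by rewrite -E => /(_ Cp).
  by rewrite E => /(_ Sp).
rewrite -(setCK (Spec_map @` C)%classic); apply: open_closedC.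
exists [set a | S (phi a) \/ phi a = 0]%classic.
apply/seteqP; split=> q /= qC Sq; apply: qC.
  have q0 a : phi a = 0 -> q a by move=> a0; apply: Sq; right.
  have [[q_0 qD qM] q1 qP] := Spec_prime q.
  have qphi a a' : phi a = phi a' -> q a' -> q a.
    move=> aa' qa'; rewrite -[a](subrK a'); apply: qD => //.
    by apply: q0; rewrite rmorphB aa' subrr.
  have pP : prime_ideal [set b | exists2 a, phi a = b & q a]%classic.
    split=> [||b b'].
    - split=> [|_ _ [a <- qa] [a' <- qa']|b _ [a <- qa]] /=.
      + by exists 0; rewrite ?rmorph0.
      + by exists (a + a'); rewrite ?rmorphD //; exact: qD.
      + have [c <-] := phi_surj b; split.
          by exists (c * a); rewrite ?rmorphM //; exact: (qM _ _ _).1.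
        by exists (a * c); rewrite ?rmorphM //; exact: (qM _ _ _).2.
    - by move=> [a a1 qa]; apply: q1; apply: qphi qa; rewrite rmorph1.
    - have [a <-] := phi_surj b; have [a' <-] := phi_surj b'.
      rewrite -rmorphM => -[d /esym/qphi dE /dE /qP[qa|qa]]; [left|right].
        by exists a.
      by exists a'.
  exists (MkSpec pP).
    apply/CE => b Sb /=; have [a ab] := phi_surj b.
    by exists a => //; apply: Sq; left; rewrite ab.
  apply: Spec_ext => a /=; split=> [[a' /esym/qphi h /h]//|qa].
  by exists a.
case: Sq => p Cp pq a; rewrite -pq /= => -[Sa|->].
  by move/CE: Cp; apply.
by case: (Spec_prime p) => -[].
Qed.

Lemma Spec_map_closed_immersion : closed_immersion Spec_map_morphism.
Proof.
split; first exact: Spec_map_inj.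
  exact: Spec_map_closed.
by move=> p; exact: loc_map_surj.
Qed.

Lemma Spec_map_over (k : comPzRingType) (iA : {rmorphism k -> A})
    (iB : {rmorphism k -> B}) : (forall c, phi (iA c) = iB c) ->
  morphism_over iB iA Spec_map_morphism.
Proof. by move=> h p c /=; rewrite loc_map_in h. Qed.
End ClosedImmersion.

(** * The character of the Ext algebra *)
Section ExtCharacter.
Variables (k : fieldType) (n r : nat) (I : set {mpoly k[n]}).
Variable c : 'I_r -> {mpoly k[n]}.
Hypothesis idealI : two_sided_ideal I.
Hypothesis generates : forall f, I f <-> exists a, f = \sum_(j < r) a j * c j.
Hypothesis minimal : forall i, ~ exists a, c i = \sum_(j < r | j != i) a j * c j.
Hypothesis c_homogeneous : forall i, exists d, (3 <= d)%N /\ c i \is d.-homog.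
Variables (R : comPzRingType) (pr : {rmorphism {mpoly k[n]} -> R}).
Hypothesis pr_surj : forall x, exists f, pr f = x.
Hypothesis pr_ker : forall f, pr f = 0 <-> I f.
Variables (M : lmodType R) (residue : R -> M).
Hypothesis residue_linear : linear (residue : R^o -> M).
Hypothesis residue_surj : forall m, exists x, residue x = m.
Hypothesis residue_ker : forall x,
  residue x = 0 <-> exists v : 'I_n -> R, x = \sum_i pr 'X_i * v i.
Variable P : proj_resolution M.

(** The image is a subring that contains the constants and the variables. *)
Lemma surjective_on_generators (phi : {rmorphism cocycle P -> {mpoly k[r]}}) :
  (forall a, exists f, phi f = a%:MP) -> (forall j, exists f, phi f = 'X_j) ->
  forall p, exists f, phi f = p.
Proof.
move=> phiC phiX p; rewrite [p]mpolyE.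
elim/big_ind: _ => [|_ _ [f <-] [g <-]|m _]; first by exists 0; rewrite rmorph0.
  by exists (f + g); rewrite rmorphD.
have [f fE] := phiC p@_m; rewrite -mul_mpolyC -fE.
suff [g <-] : exists g, phi g = 'X_[m] by exists (f * g); rewrite rmorphM.
rewrite mpolyXE_id; elim/big_ind: _ => [|_ _ [g <-] [h <-]|i _].
- by exists 1; rewrite rmorph1.
- by exists (g * h); rewrite rmorphM.
- by have [g <-] := phiX i; exists (g ^+ m i); rewrite rmorphXn.
Qed.

Theorem cocycle_character : exists phi : {rmorphism cocycle P -> {mpoly k[r]}},
  [/\ forall f, coboundaries f -> phi f = 0,
      forall a : k, phi (coc_scalar P (pr a%:MP)) = a%:MP &
      forall p, exists f, phi f = p].
Proof.
have [q [q0 cq]] := cubic_factor (c_vanishes c_homogeneous).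
pose t i := pr 'X_i; pose Q j i m := pr (q j i m).
have kill := pr_kill generates c_homogeneous pr_surj pr_ker residue_linear
  residue_surj residue_ker.
have tM0 i (x : M) : t i *: x = 0 by apply: kill; exact: mcoeffX0.
have QM0 j i m (x : M) : Q j i m *: x = 0 by exact: kill.
have cI j : I (c j).
  apply/generates; exists (fun i => (i == j)%:R).
  rewrite (bigD1 j) //= eqxx mul1r big1 ?addr0 // => i /negPf->.
  by rewrite mul0r.
have half j i : half_coef t Q i j = pr (\sum_m 'X_m * q j i m).
  by rewrite rmorph_sum; apply: eq_bigr => m _; rewrite rmorphM.
have potential0 j : \sum_i t i * half_coef t Q i j = 0.
  rewrite -[RHS](iffRL (pr_ker (c j)) (cI j)) cq rmorph_sum.
  by apply: eq_bigr => i _; rewrite half rmorphM.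
have [z [z_cycle [b z0 aug_b] z_hom]] := cycle_lifting P potential0 tM0 QM0 (residue 1).
have z_aug : map_coef (res_aug P) (z 0%N) = unit_ext (residue 1).
  by rewrite z0 map_coef_unit aug_b.
pose kap := residue_val pr_surj residue_surj.
have kapB : zmod_morphism kap by exact: (residue_valB generates).
have kapZ a x : kap (scalar pr a *: x) = a * kap x.
  rewrite /kap (residue_valZ generates c_homogeneous) //.
  by rewrite mcoeffC eqxx mulr1.
have kap1 : kap (residue 1) = 1 by exact: (residue_val1 generates).
have kapK x : scalar pr (kap x) *: residue 1 = x by exact: (residue_valK generates).
pose phi f := symbol kapB z f.
have phiB : zmod_morphism phi by exact: symbolB.
have phiC a : phi (coc_scalar P (pr a%:MP)) = a%:MP.
  exact: (symbol_scalar kapB kapZ kap1 z_aug a).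
have phiM : monoid_morphism phi.
  split=> [|f g]; last exact: (symbolM potential0 tM0 QM0 kapB kapZ kap1 kapK z_cycle z_aug z_hom).
  have <- : coc_scalar P (pr 1%:MP) = 1 by rewrite !rmorph1.
  by rewrite phiC.
pose Phi : {rmorphism cocycle P -> {mpoly k[r]}} := HB.pack phi
  (GRing.isZmodMorphism.Build _ _ phi phiB) (GRing.isMonoidMorphism.Build _ _ phi phiM).
exists Phi; split=> [f fB|a|].
- exact: (symbol_coboundary tM0 QM0 kapB z_cycle).
- exact: phiC.
apply: surjective_on_generators => [a|j]; first by exists (coc_scalar P (pr a%:MP)); exact: phiC.
have [g [gd gE]] := degree_two_functional idealI generates minimal c_homogeneous
  pr_surj pr_ker residue_linear residue_surj residue_ker j cq (cycle_d2 z_cycle) (fun i l => cycle_d1 z_cycle z0 i l) aug_b.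
have [f [f2 f0]] := degree_two_cocycle gd.
exists f; apply/mpolyP => a; rewrite [LHS]symbolE mcoeffX /symbol_coef.
have [a1|a1] := eqVneq (mdeg a) 1%N.
  have /mdeg1P[l /eqP->] : mdeg a == 1%N by rewrite a1.
  have -> : (U_(j) == U_(l) :> 'X_{1..r})%MM = (j == l).
    apply/eqP/eqP => [/mnmP/(_ j)|->//]; rewrite !mnm1E eqxx.
    by case: eqP => // ->.
  by rewrite mdeg1 f2 [LHS]gE.
rewrite f0; last by rewrite -[2%N]/(1.*2) (inj_eq double_inj).
rewrite linear0 (_ : kap 0 = 0); last by rewrite -(subrr 0) kapB subrr.
by case: eqP => // E; rewrite -E mdeg1 in a1.
Qed.
End ExtCharacter.

Theorem theorem4p10 (k : fieldType) (n r : nat) (I : set {mpoly k[n]})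
    (c : 'I_r -> {mpoly k[n]})
    (char0 : [pchar k] =i pred0)
    (idealI : two_sided_ideal I)
    (generates : forall f, I f <-> exists a, f = \sum_(j < r) a j * c j)
    (minimal : forall i, ~ exists a, c i = \sum_(j < r | j != i) a j * c j)
    (c_homogeneous : forall i, exists d, (3 <= d)%N /\ c i \is d.-homog)
    (P : proj_resolution (residue_module I)) :
  has_closed_affine_space (@Ext_ab_scalar k n I P) r.
Proof.
pose t (i : 'I_n) : coord_ring I := coord_proj I 'X_i.
pose residue (x : coord_ring I) : residue_module I := @qproj _ (range t) x.
have pr_ker f : coord_proj I f = 0 <-> I f.
  split=> [|If].
    by rewrite -(rmorph0 (coord_proj I)) => /qprojP; rewrite subr0; apply.
  rewrite -(rmorph0 (coord_proj I)); apply/qprojP; rewrite subr0.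
  by move=> J _; apply.
have residue_linear : linear (residue : (coord_ring I)^o -> residue_module I).
  move=> a x y; rewrite /residue (rmorphD (@qproj _ (range t))).
  by congr (_ + _); exact: (rmorphM (@qproj _ (range t))).
have residue_ker x :
    residue x = 0 <-> exists v, x = \sum_i coord_proj I 'X_i * v i.
  rewrite -(rmorph0 (@qproj _ (range t))); split.
    by move=> /qprojP; rewrite subr0; exact: ideal_gen_linear_comb.
  move=> [v ->]; apply/qprojP; rewrite subr0 => J [J0 JD JM] tJ.
  elim/big_ind: _ => // i _; apply: (JM _ _ _).2.
  by apply: tJ; exists i.
have [phi [phiB phiC phi_surj]] := cocycle_character idealI generates minimal
  c_homogeneous (pr := coord_proj I) (@qproj_surj _ _) pr_ker residue_linear
  (@qproj_surj _ _) residue_ker P.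
have [phi' phi'E] := quotient_map phiB.
have [psi psiE] : exists psi : {rmorphism abelianization (Ext P) -> {mpoly k[r]}},
    forall x, psi (abproj x) = phi' x.
  apply: quotient_map => _ [x [y ->]].
  by rewrite rmorphB !rmorphM mulrC subrr.
exists (Spec_map_morphism psi); split.
  apply: Spec_map_closed_immersion => p; have [f <-] := phi_surj p.
  by exists (abproj (qproj _ f)); rewrite psiE phi'E.
apply: Spec_map_over => a.
rewrite -[RHS]phiC -phi'E.
exact: psiE.
Qed.
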